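(* Let $A=\Bbbk Q/J^2$, where $Q$ is a finite quiver and $J$ is the two-sided ideal of $\Bbbk Q$ generated by the arrows. Then the shifted Bardzell complex $B^*(A)[1]$ (with the $L_\infty$-structure $(l_n)$ of the context) is a dg-Lie algebra, i.e. $l_n=0$ for all $n\ge3$, and $G^*:B^*(A)[1]\to\overline C^*(A)[1]$ is a quasi-isomorphism of dg-Lie algebras. In particular, there is a bijection $$\mathcal{MC}(\overline C^*(A)[1]\otimes(t))\simeq\mathcal{MC}(B^*(A)[1]\otimes(t)),$$ and $f=\sum_{i\ge1}f_it^i$ with $f_i\in\operatorname{Hom}_{E-E}(\Bbbk AP_2,A)$ satisfies the Maurer-Cartan equation in $B^*(A)[1]\otimes(t)$ if and only if, for every $i\geq 1$ and every $(\alpha_1\alpha_2,\alpha_2\alpha_3)\in AP_3$, $$f_i(\alpha_1\alpha_2)\alpha_3-\alpha_1f_i(\alpha_2\alpha_3)+\sum_{j+k=i}f_jG_2\big(1\otimes f_k(\alpha_1\alpha_2)\otimes\alpha_3\otimes1-1\otimes\alpha_1\otimes f_k(\alpha_2\alpha_3)\otimes1\big)=0.$$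
   Context: $\Bbbk$ is a field of characteristic zero, $E=\Bbbk Q_0$, $A=E\oplus\operatorname{rad}A$ with $\operatorname{rad}A$ spanned by the arrows; write $a=a_E+a_r$. Paths $\alpha_1\cdots\alpha_l$ satisfy $t(\alpha_i)=s(\alpha_{i+1})$. For $A=\Bbbk Q/J^2$, the set $AP_n$ of supports of $n$-concatenations is the set of all paths of length $n$ in $Q$; the element $\alpha_1\alpha_2\alpha_3$ of $AP_3$ is denoted $(\alpha_1\alpha_2,\alpha_2\alpha_3)$. Resolutions. $\overline C_n(A)=A\otimes_E(\operatorname{rad}A)^{\otimes_En}\otimes_EA$, $d_n(a_0\otimes\cdots\otimes a_{n+1})=\sum_{i=0}^n(-1)^ia_0\otimes\cdots\otimes a_ia_{i+1}\otimes\cdots\otimes a_{n+1}$, $s_n(a\otimes x)=1\otimes a_r\otimes x$. Bardzell's resolution: $B_n(A)=A\otimes_E\Bbbk AP_n\otimes_EA$ with $\delta_n(1\otimes\alpha_1\cdots\alpha_n\otimes1)=\alpha_1\otimes\alpha_2\cdots\alpha_n\otimes1+(-1)^n\,1\otimes\alpha_1\cdots\alpha_{n-1}\otimes\alpha_n$. The comparison morphisms are the $A$-bimodule maps $F_n:B_n(A)\to\overline C_n(A)$, $F_n(1\otimes\alpha_1\cdots\alpha_n\otimes1)=1\otimes\alpha_1\otimes\cdots\otimes\alpha_n\otimes1$, and $G_n:\overline C_n(A)\to B_n(A)$, $G_n(1\otimes\alpha_1\otimes\cdots\otimes\alpha_n\otimes1)=1\otimes\alpha_1\cdots\alpha_n\otimes1$,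 for arrows $\alpha_i$ with $\alpha_1\cdots\alpha_n$ a path ($F_0=G_0=\mathrm{Id}$). $H_n:\overline C_n(A)\to\overline C_{n+1}(A)$ are the $A$-bimodule maps with $H_0=0$, $H_n(1\otimes x)=(s_nF_nG_n-s_nH_{n-1}d_n)(1\otimes x)$. Cochains. $f\in\operatorname{Hom}_{E-E}(V,A)$ corresponds to $\hat f\in\operatorname{Hom}_{A-A}(A\otimes_EV\otimes_EA,A)$, $f(v)=\hat f(1\otimes v\otimes1)$. $\overline C^n(A)=\operatorname{Hom}_{E-E}((\operatorname{rad}A)^{\otimes_En},A)$, $d^nf=(-1)^n\hat fd_{n+1}$; $B^n(A)=\operatorname{Hom}_{E-E}(\Bbbk AP_n,A)$ with differential $(-1)^n\delta^n$, $\delta^n(f)=\hat f\delta_{n+1}$. $F^n(f)=\hat fF_n$, $G^n(f)=\hat fG_n$, $H^n(f)=(-1)^{n-1}\hat fH_{n-1}$. Expressions $f_jG_2(1\otimes x\otimes y\otimes1)$ mean $\hat f_j(G_2(1\otimes x_r\otimes y_r\otimes1))$ for $x,y\in A$. Gerstenhaber bracket of $f\in\overline C^n(A)$, $g\in\overline C^m(A)$: $f\circ g=\sum_{i=0}^{n-1}(-1)^{i(m+1)}f(\mathrm{Id}^{\otimes i}\otimes g\otimes\mathrm{Id}^{\otimes n-i-1})$, $[f,g]=f\circ g-(-1)^{(n-1)(m-1)}g\circ f$ (cochains are extended by zero when an argument lies in $E$). Shift: $X[1]^n=X^{n+1}$ with differential multiplied by $-1$. So $\overline C^*(A)[1]$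 is a dg-Lie algebra with differential $-d$ and this bracket, and $B^*(A)[1]$ has differential $-(-1)^{n+1}\delta^{n+1}$ in degree $n$. $L_\infty$-structure on $B=B^*(A)[1]$. For homogeneous $x_1,\dots,x_n$ and $\sigma\in\mathbb S_n$: $x_1\wedge\dots\wedge x_n=\varepsilon(\sigma)x_{\sigma(1)}\wedge\dots\wedge x_{\sigma(n)}$ in the free graded commutative algebra, $\chi(\sigma)=\operatorname{sgn}(\sigma)\varepsilon(\sigma)$, $\kappa(\sigma)_t=(-1)^{(t-1)+(n-t-1)\sum_{p=1}^t|x_{\sigma(p)}|}$, $\hat\sigma(x_1\otimes\dots\otimes x_n)=x_{\sigma(1)}\otimes\dots\otimes x_{\sigma(n)}$; $\mathbb S_{t,n-t}$ is the set of $\sigma\in\mathbb S_n$ with $\sigma(1)<\dots<\sigma(t)$, $\sigma(t+1)<\dots<\sigma(n)$, and $\mathbb S^-_{t,n-t}$ the subset with $\sigma(1)<\sigma(t+1)$. Put $h=-H^*$ (the homotopy for the shifted differentials). $l_1$ is the differential of $B$, $u_1=v_1=0$, $\phi_1=G^*$, and for $n>1$: $v_n=\sum_{t=1}^{n-1}\sum_{\tau\in\mathbb S^-_{t,n-t}}\chi(\tau)\kappa(\tau)_t[\phi_t,\phi_{n-t}]\hat\tau$, $l_n=F^*v_n$, $u_n=\sum_{k=2}^n\sum_{\tau\in\mathbb S_{k,n-k}}(-1)^{k(n-k)+1}\chi(\tau)\phi_{n-k+1}(l_k\otimes\mathrm{Id}^{\otimes n-k})\hat\tau$, $\phi_n=h(u_n+v_n)$,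 where $[\phi_s,\phi_t]$ applies $\phi_s$ to the first $s$ factors, $\phi_t$ to the last $t$ and takes the bracket. In particular $l_2(f\otimes g)=F^*[G^*f,G^*g]$; the dg-Lie structure is given by the differential $l_1$ and the bracket $l_2$. Maurer-Cartan. $(t)$ is the ideal of $\Bbbk[[t]]$ generated by $t$; degree $1$ elements of $L\otimes(t)$ are series $\sum_{i\ge1}f_it^i$, $f_i\in L^1$, with the structure extended $t$-linearly. For a dg-Lie algebra, $\mathcal{MC}$ is the set of degree $1$ elements $f$ with $\partial f+\frac12[f,f]=0$ ($\partial$ the differential); for $B^*(A)[1]\otimes(t)$ it reads $-\delta^2(f)+\frac12l_2(f\otimes f)=0$. *)

(* Defs.v *)
From HB Require Import structures.
From mathcomp Require Import all_boot all_order all_algebra all_fingroup.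
From mathcomp Require Import boolp classical_sets functions.

Set Implicit Arguments.
Unset Strict Implicit.
Unset Printing Implicit Defensive.

Import Order.TTheory GRing.Theory Num.Theory.
Local Open Scope ring_scope.

Record quiver := Quiver {
  vert : finType;
  arrow : finType;
  src : arrow -> vert;
  tgt : arrow -> vert }.

Section Paths.
Variable Q : quiver.

Fixpoint chain (v : vert Q) (s : seq (arrow Q)) : bool :=
  if s is a :: s' then (src a == v) && chain (tgt a) s' else true.

Definition chain_end (v : vert Q) (s : seq (arrow Q)) : vert Q :=
  foldl (fun _ a => tgt a) v s.

(* The start vertex is recorded, so that the words of length 0 give the
   trivial paths e_v. *)
Definition qpath := {p : vert Q * seq (arrow Q) | chain p.1 p.2}.

Definition start (p : qpath) : vert Q := (val p).1.
Definition word (p : qpath) : seq (arrow Q) := (val p).2.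
Definition len (p : qpath) : nat := size (word p).
Definition finish (p : qpath) : vert Q := chain_end (start p) (word p).

Lemma chain_take v s i : chain v s -> chain v (take i s).
Proof.
elim: s v i => [|a s IH] v [|i] //= /andP[-> /IH h]; exact: h.
Qed.

Lemma chain_drop v s i : chain v s -> chain (chain_end v (take i s)) (drop i s).
Proof.
elim: s v i => [|a s IH] v [|i] //= /andP[_ h]; exact: IH.
Qed.

Lemma subp_chain (p : qpath) i m :
  chain (chain_end (start p) (take i (word p))) (take m (drop i (word p))).
Proof. by apply/chain_take/chain_drop; case: p. Qed.

(* The subpath alpha_(i+1) ... alpha_(i+m) of alpha_1 alpha_2 ... *)
Definition subp (p : qpath) (i m : nat) : qpath :=
  exist (fun p : vert Q * seq (arrow Q) => chain p.1 p.2)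
    (chain_end (start p) (take i (word p)), take m (drop i (word p)))
    (subp_chain p i m).

Definition vpath (v : vert Q) : qpath :=
  exist (fun p : vert Q * seq (arrow Q) => chain p.1 p.2) (v, [::]) isT.

Lemma apath_chain (a : arrow Q) : chain (src a) [:: a].
Proof. by rewrite /= eqxx. Qed.

Definition apath (a : arrow Q) : qpath :=
  exist (fun p : vert Q * seq (arrow Q) => chain p.1 p.2)
    (src a, [:: a]) (apath_chain a).

Lemma path2_chain (a b : arrow Q) : tgt a = src b -> chain (src a) [:: a; b].
Proof. by move=> h; rewrite /= eqxx h eqxx. Qed.

Definition path2 (a b : arrow Q) (h : tgt a = src b) : qpath :=
  exist (fun p : vert Q * seq (arrow Q) => chain p.1 p.2)
    (src a, [:: a; b]) (path2_chain h).

Definition AP (n : nat) : finType :=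
  {p : vert Q * n.-tuple (arrow Q) | chain p.1 p.2}.

Definition qp n (p : AP n) : qpath :=
  exist (fun p : vert Q * seq (arrow Q) => chain p.1 p.2)
    ((val p).1, tval (val p).2) (valP p).

(* Basis of A = kQ/J^2: the paths of length 0 and 1. *)
Definition basis : finType := (vert Q + arrow Q)%type.
Definition bsrc (b : basis) : vert Q :=
  match b with inl v => v | inr a => src a end.
Definition btgt (b : basis) : vert Q :=
  match b with inl v => v | inr a => tgt a end.
Definition is_arrow (b : basis) : bool := if b is inr _ then true else false.
Definition bpath (b : basis) : qpath :=
  match b with inl v => vpath v | inr a => apath a end.

End Paths.

Section Algebra.
Variables (k : fieldType) (Q : quiver).

(* kQ/J^2, in its basis of paths of length at most 1; see rsz_quotient. *)
Definition rsz := {ffun basis Q -> k^o}.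
HB.instance Definition _ := GRing.Lmodule.copy rsz {ffun basis Q -> k^o}.

Definition rsz_one : rsz := [ffun b => if b is inl _ then 1 else 0].
Definition rsz_mul (x y : rsz) : rsz :=
  [ffun b => match b with
             | inl v => x (inl v) * y (inl v)
             | inr a => x (inl (src a)) * y (inr a) + x (inr a) * y (inl (tgt a))
             end].

Fact rsz_mulA : associative rsz_mul.
Proof.
move=> x y z; apply/ffunP => -[v|a]; rewrite !ffunE ?mulrA //.
by rewrite mulrDr mulrDl !mulrA addrA.
Qed.
Fact rsz_mul1 : left_id rsz_one rsz_mul.
Proof.
by move=> x; apply/ffunP => -[v|a]; rewrite !ffunE mul1r // mul0r addr0.
Qed.
Fact rsz_mulr1 : right_id rsz_one rsz_mul.
Proof.
by move=> x; apply/ffunP => -[v|a]; rewrite !ffunE mulr1 // mulr0 add0r.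
Qed.
Fact rsz_mulDl : left_distributive rsz_mul +%R.
Proof.
move=> x y z; apply/ffunP => -[v|a]; rewrite !ffunE !mulrDl //.
by rewrite !addrA; congr (_ + _); rewrite -!addrA; congr (_ + _); rewrite addrC.
Qed.
Fact rsz_mulDr : right_distributive rsz_mul +%R.
Proof.
move=> x y z; apply/ffunP => -[v|a]; rewrite !ffunE !mulrDr //.
by rewrite !addrA; congr (_ + _); rewrite -!addrA; congr (_ + _); rewrite addrC.
Qed.
HB.instance Definition _ := GRing.Zmodule_isPzRing.Build rsz
  rsz_mulA rsz_mul1 rsz_mulr1 rsz_mulDl rsz_mulDr.

Definition bas (b : basis Q) : rsz := [ffun b' => (b' == b)%:R].
Definition idem (v : vert Q) : rsz := bas (inl v).
Definition arr (a : arrow Q) : rsz := bas (inr a).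

(* x_r, the component of x in rad A = k Q_1. *)
Definition radp (x : rsz) : rsz := [ffun b => if is_arrow b then x b else 0].

(* The path algebra kQ, as the finitely supported functions on paths, with the
   convolution product dual to the concatenation of paths. *)
Definition finsupp (x : qpath Q -> k) : Prop :=
  exists s : seq (qpath Q), forall p, p \notin s -> x p = 0.
Definition kQ_path (p : qpath Q) : qpath Q -> k := fun q => (q == p)%:R.
Definition kQ_one : qpath Q -> k := fun p => (len p == 0)%:R.
Definition kQ_mul (x y : qpath Q -> k) : qpath Q -> k := fun p =>
  \sum_(i < (len p).+1) x (subp p 0 i) * y (subp p i (len p - i)).

Inductive in_J : (qpath Q -> k) -> Prop :=
| J_arrow a : in_J (kQ_path (apath a))
| J_zero : in_J (fun _ => 0)
| J_add x y : in_J x -> in_J y -> in_J (fun p => x p + y p)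
| J_mull x y : finsupp x -> in_J y -> in_J (kQ_mul x y)
| J_mulr x y : in_J x -> finsupp y -> in_J (kQ_mul x y).

Inductive in_J2 : (qpath Q -> k) -> Prop :=
| J2_zero : in_J2 (fun _ => 0)
| J2_add x y : in_J2 x -> in_J2 y -> in_J2 (fun p => x p + y p)
| J2_mul x y : in_J x -> in_J y -> in_J2 (kQ_mul x y).

Definition rsz_proj (x : qpath Q -> k) : rsz := [ffun b => x (bpath b)].

Lemma qpath_eq (p q : qpath Q) : start p = start q -> word p = word q -> p = q.
Proof.
case: p q => [[v s] hp] [[w t] hq]; rewrite /start /word /= => e1 e2.
by apply/val_inj; rewrite /= e1 e2.
Qed.

Lemma rsz_projM x y : rsz_proj (kQ_mul x y) = rsz_proj x * rsz_proj y.
Proof.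
apply/ffunP => -[v|a]; rewrite !ffunE /= /kQ_mul /len /=.
  by rewrite big_ord1; congr (x _ * y _); apply: qpath_eq.
rewrite big_ord_recl big_ord1 /=.
by congr (x _ * y _ + x _ * y _); apply: qpath_eq.
Qed.

Lemma rsz_proj1 : rsz_proj kQ_one = 1.
Proof. by apply/ffunP => -[v|a]; rewrite !ffunE /kQ_one /len. Qed.

Lemma bpath_inj : injective (@bpath Q).
Proof.
move=> [v|a] [w|b] // h.
  by move: (congr1 (@start Q) h); rewrite /start /= => ->.
by move: (congr1 (@word Q) h); rewrite /word /= => -[->].
Qed.

Lemma rsz_proj_surj (a : rsz) : exists2 x, finsupp x & rsz_proj x = a.
Proof.
exists (fun p => \sum_(b : basis Q) a b * (p == bpath b)%:R).
  exists [seq bpath b | b <- enum (basis Q)] => p hp.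
  apply: big1 => b _; case: eqP => [e|]; last by rewrite mulr0.
  by case/negP: hp; rewrite e map_f // mem_enum.
apply/ffunP => b; rewrite ffunE (bigD1 b) //= eqxx mulr1 big1 ?addr0 //.
move=> b' nb; case: eqP => [/bpath_inj e|]; last by rewrite mulr0.
by rewrite e eqxx in nb.
Qed.

Lemma kQ_path_split (p : qpath Q) i (c : k) : (i <= len p)%N ->
  kQ_mul (fun q => c * kQ_path (subp p 0 i) q)
    (kQ_path (subp p i (len p - i))) = fun q => c * kQ_path p q.
Proof.
move=> hi; apply: funext => q; rewrite /kQ_mul /kQ_path.
case: (eqVneq q p) => [->|npq].
  rewrite (bigD1 (inord i)) //= inordK ?ltnS // !eqxx !mulr1 big1 ?addr0 //.
  move=> j nj; case: eqP => [e|]; last by rewrite mulr0 mul0r.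
  case/eqP: nj; apply: val_inj; rewrite /= inordK ?ltnS //.
  move/(congr1 (fun p => size (word p))): e; rewrite /word /= drop0.
  by rewrite !size_takel // -ltnS; exact: ltn_ord.
rewrite mulr0 big1 // => j _.
case: eqP => [e1|]; last by rewrite mulr0 mul0r.
case: eqP => [e2|]; last by rewrite mulr0.
case/eqP: npq; apply: qpath_eq.
  by move/(congr1 (fun p => start p)): e1; rewrite /start /= !take0.
move/(congr1 (fun p => word p)): e1; rewrite /word /= !drop0 => e1.
move/(congr1 (fun p => word p)): e2; rewrite /word /= => e2.
move: e2; rewrite !take_oversize ?size_drop // => e2.
by rewrite /word -(cat_take_drop j (val q).2) -(cat_take_drop i (val p).2) e1 e2.
Qed.

Lemma finsupp_path c p : finsupp (fun q => c * kQ_path p q).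
Proof.
exists [:: p] => q; rewrite inE /kQ_path => /negbTE ->; exact: mulr0.
Qed.

Lemma in_J_path (p : qpath Q) c : (0 < len p)%N -> in_J (fun q => c * kQ_path p q).
Proof.
move=> hp; rewrite -(@kQ_path_split p 1 c) //.
have [a ha] : exists a, subp p 0 1 = apath a.
  case: p hp => [[v [|a s]] cp] // _; exists a; apply: qpath_eq => //=.
    by rewrite /start /=; case/andP: (cp) => /eqP.
  by rewrite /word /= take0.
rewrite ha; apply: J_mulr; last first.
  by have := finsupp_path 1 (subp p 1 (len p - 1)); congr finsupp;
    apply: funext => q; rewrite mul1r.
rewrite -(@kQ_path_split (apath a) 0 c) //; apply: J_mull.
  exact: finsupp_path.
have -> : subp (apath a) 0 (len (apath a) - 0) = apath a by apply: qpath_eq.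
exact: J_arrow.
Qed.

Lemma len_subp (p : qpath Q) i m : len (subp p i m) = minn m (len p - i).
Proof. by rewrite /len size_take_min size_drop. Qed.

Lemma in_J2_path (p : qpath Q) c :
  (1 < len p)%N -> in_J2 (fun q => c * kQ_path p q).
Proof.
move=> hp; rewrite -(kQ_path_split c (ltnW hp)).
apply: J2_mul.
  by apply: in_J_path; rewrite len_subp subn0 leq_min /= ltnW.
have -> : kQ_path (subp p 1 (len p - 1)) =
    fun q => 1 * kQ_path (subp p 1 (len p - 1)) q.
  by apply: funext => q; rewrite mul1r.
by apply: in_J_path; rewrite len_subp minnn subn_gt0.
Qed.

Lemma in_J_proj x v : in_J x -> rsz_proj x (inl v) = 0.
Proof.
elim => [a||{}x y _ hx _ hy|{}x y _ _ hy|{}x y _ hx _].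
- by rewrite ffunE /kQ_path; case: eqP => // /(congr1 (@len Q)).
- by rewrite ffunE.
- by move: hx hy; rewrite !ffunE => -> ->; rewrite addr0.
- by rewrite rsz_projM ffunE hy mulr0.
- by rewrite rsz_projM ffunE hx mul0r.
Qed.

(* kQ -> rsz is a surjective morphism of algebras with kernel J^2. *)
Lemma rsz_quotient :
  [/\ forall x y, rsz_proj (kQ_mul x y) = rsz_proj x * rsz_proj y,
      rsz_proj kQ_one = 1,
      forall (c : k) x y,
        rsz_proj (fun p => c * x p + y p) = c *: rsz_proj x + rsz_proj y,
      forall a : rsz, exists2 x, finsupp x & rsz_proj x = a &
      forall x, finsupp x -> rsz_proj x = 0 <-> in_J2 x].
Proof.
split; [exact: rsz_projM|exact: rsz_proj1| |exact: rsz_proj_surj|].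
  by move=> c x y; apply/ffunP => b; rewrite !ffunE.
move=> x [s hs]; split; last first.
  elim => [|{hs}x y _ hx _ hy|{hs}x y hx hy]; first by apply/ffunP=> b; rewrite !ffunE.
    by apply/ffunP => b; move/ffunP/(_ b): hx; move/ffunP/(_ b): hy;
      rewrite !ffunE => -> ->; rewrite addr0.
  rewrite rsz_projM; apply/ffunP => -[v|a]; rewrite !ffunE.
    by move: (in_J_proj v hx); rewrite ffunE => ->; rewrite mul0r.
  move: (in_J_proj (src a) hx) (in_J_proj (tgt a) hy); rewrite !ffunE => -> ->.
  by rewrite mul0r mulr0 addr0.
move=> px; have x0 p : (len p < 2)%N -> x p = 0.
  case: p => [[v [|a [|b s']]] hp] // _.
    have := congr1 (fun f : rsz => f (inl v)) px; rewrite !ffunE => <-.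
    by congr x; apply: qpath_eq.
  have := congr1 (fun f : rsz => f (inr a)) px; rewrite !ffunE => <-.
  by congr x; apply: qpath_eq => //; rewrite /start /=; case/andP: (hp) => /eqP.
elim: s x hs {px} x0 => [|p s IH] x hs x0.
  by have -> : x = fun _ => 0 by [apply: funext => p; exact: hs]; exact: J2_zero.
have -> : x = fun q => x p * kQ_path p q + (if q == p then 0 else x q).
  apply: funext => q; rewrite /kQ_path; case: eqP => [->|_].
    by rewrite mulr1 addr0.
  by rewrite mulr0 add0r.
apply: J2_add.
  case: (ltnP 1 (len p)) => [|/x0 ->]; first exact: in_J2_path.
  have -> : (fun q => 0 * kQ_path p q) = (fun _ => 0)
    by apply: funext => q; rewrite mul0r.
  exact: J2_zero.
apply: IH => q hq; case: eqP => // /eqP nq.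
- by apply: hs; rewrite inE negb_or nq.
- exact: x0.
Qed.

End Algebra.

Section Complexes.
Variables (k : fieldType) (Q : quiver).
Local Notation A := (rsz k Q).
Local Notation bas := (@bas k Q).
Local Notation idem := (@idem k Q).
Local Notation arr := (@arr k Q).

(* Basis of A (x)_E (rad A)^{(x)_E n} (x)_E A, for E = k Q_0: the tensors
   b_0 (x) ... (x) b_(n+1) of paths of length at most 1 with b_1, ..., b_n
   arrows and t(b_i) = s(b_(i+1)), the other ones being 0. *)
Definition bar_idx (n : nat) : finType :=
  {b : n.+2.-tuple (basis Q) |
    sorted (fun x y => btgt x == bsrc y) b &&
    [forall i : 'I_n.+2, (0 < i < n.+1)%N ==> is_arrow (tnth b i)]}.
Definition bar (n : nat) := {ffun bar_idx n -> k^o}.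

(* a_0 (x) (a_1)_r (x) ... (x) (a_n)_r (x) a_(n+1). *)
Definition tens n (a : nat -> A) : bar n :=
  [ffun b : bar_idx n => \prod_(i < n.+2) a i (tnth (val b) i)].

(* The factor b_j of a basis tensor. *)
Definition bfac n (b : bar_idx n) (j : nat) : A := nth 0 (map bas (val b)) j.

Lemma tens_basis n (b : bar_idx n) :
  tens n (bfac b) = [ffun b' => (b' == b)%:R].
Proof.
apply/ffunP => b'; rewrite !ffunE.
have bE (i : 'I_n.+2) : bfac b i (tnth (val b') i) =
    (tnth (val b') i == tnth (val b) i)%:R.
  rewrite /bfac (nth_map (tnth (val b) i)) ?size_tuple ?ltn_ord // ffunE.
  by rewrite -tnth_nth.
case: eqP => [eb|nb]; first by apply: big1 => i _; rewrite bE eb eqxx.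
have [i ni] : exists i, tnth (val b') i != tnth (val b) i.
  apply/existsP; rewrite -negb_forall; apply/forallP => h; apply: nb.
  by apply/val_inj/eq_from_tnth => i; apply/eqP.
by rewrite (bigD1 i) //= bE (negbTE ni) mul0r.
Qed.

Lemma tensD1 n (a : nat -> A) (b : bar_idx n) (i : 'I_n.+2) :
  tens n a b = a i (tnth (val b) i) *
    \prod_(j < n.+2 | j != i) a j (tnth (val b) j).
Proof. by rewrite ffunE (bigD1 i). Qed.

Lemma tens_linear n (a : nat -> A) (i : 'I_n.+2) (c : k) (x y : A) :
  let upd z j := if j == i :> nat then z else a j in
  tens n (upd (c *: x + y)) = c *: tens n (upd x) + tens n (upd y).
Proof.
move=> upd; apply/ffunP => b.
have E z : tens n (upd z) b = z (tnth (val b) i) *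
    \prod_(j < n.+2 | j != i) a j (tnth (val b) j).
  rewrite (tensD1 _ _ i) /upd eqxx; congr (_ * _).
  by apply: eq_bigr => j nj; rewrite val_eqE (negbTE nj).
have -> : (c *: tens n (upd x) + tens n (upd y)) b =
    c * tens n (upd x) b + tens n (upd y) b by rewrite !ffunE.
rewrite !E mulrA -mulrDl; congr (_ * _); by rewrite !ffunE.
Qed.

Lemma tens_balanced n (a : nat -> A) i v : (i < n.+1)%N ->
  tens n (fun j => if j == i then a i * idem v else a j) =
  tens n (fun j => if j == i.+1 then idem v * a i.+1 else a j).
Proof.
move=> hi; apply/ffunP => b.
have hi1 : (i < n.+2)%N by rewrite ltnS ltnW.
pose i0 := Ordinal hi1; pose i1 := Ordinal (hi : (i.+1 < n.+2)%N).
have ne : i1 != i0 by rewrite -val_eqE /= gtn_eqF.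
have E (c : nat -> A) : tens n c b = c i (tnth (val b) i0) *
    (c i.+1 (tnth (val b) i1) *
     \prod_(j < n.+2 | (j != i0) && (j != i1)) c j (tnth (val b) j)).
  by rewrite (tensD1 _ _ i0) (bigD1 i1).
rewrite !E !eqxx [i.+1 == i]gtn_eqF // [i == i.+1]ltn_eqF // !mulrA.
congr (_ * _); last first.
  apply: eq_bigr => j /andP[j0 j1]; rewrite -!val_eqE /= in j0 j1.
  by rewrite (negbTE j0) (negbTE j1).
have ridem (x : A) c : (x * idem v) c = x c * (btgt c == v)%:R.
  by case: c => w; rewrite !ffunE /= ?mulr0 ?add0r ?addr0.
have lidem (x : A) c : (idem v * x) c = (bsrc c == v)%:R * x c.
  by case: c => w; rewrite !ffunE /= ?mul0r ?add0r ?addr0.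
rewrite ridem lidem -mulrA; congr (_ * (_%:R * _)); congr nat_of_bool.
case/andP: (valP b) => sb _.
have d : basis Q := tnth (val b) i0.
rewrite !(tnth_nth d) /=.
by move/(sortedP d)/(_ i): sb; rewrite size_tuple => /(_ hi) /eqP ->.
Qed.

Definition bar_lact n (a : A) (x : bar n) : bar n :=
  \sum_b x b *: tens n (fun j => if j == 0%N then a * bfac b 0 else bfac b j).

Definition contract (i : nat) (a : nat -> A) (j : nat) : A :=
  if (j < i)%N then a j else if j == i then a i * a i.+1 else a j.+1.

Definition bar_d n (x : bar n.+1) : bar n :=
  \sum_b x b *: \sum_(i < n.+2) (-1) ^+ i *: tens n (contract i (bfac b)).

Definition bar_s n (x : bar n) : bar n.+1 :=
  \sum_b x b *: tens n.+1 (fun j => if j == 0%N then 1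
                                    else if j == 1%N then radp (bfac b 0)
                                    else bfac b j.-1).

(* k AP_n, and A (x)_E k AP_n (x)_E A in the basis of the tensors
   b (x) p (x) b' with t(b) = s(p) and t(p) = s(b'). *)
Definition kAP (n : nat) := {ffun AP Q n -> k^o}.
Definition bdz_idx (n : nat) : finType :=
  {t : (basis Q * AP Q n * basis Q)%type |
    (btgt t.1.1 == start (qp t.1.2)) && (finish (qp t.1.2) == bsrc t.2)}.
Definition bdz (n : nat) := {ffun bdz_idx n -> k^o}.

Definition btens n (a : A) (w : kAP n) (a' : A) : bdz n :=
  [ffun t : bdz_idx n => a (val t).1.1 * w (val t).1.2 * a' (val t).2].

(* The path p, as an element of k AP_n for n = len p. *)
Definition kpath n (p : qpath Q) : kAP n := [ffun q : AP Q n => (qp q == p)%:R].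

(* alpha_1 ... alpha_n, extended multilinearly to elements of A through their
   components in rad A; it is 1 in k AP_0 = E for n = 0. *)
Definition concat n (a : nat -> A) : kAP n :=
  [ffun p : AP Q n => \prod_(i < n) a i (inr (tnth (val p).2 i))].

(* The j-th arrow of p, counting from 0. *)
Definition parr (p : qpath Q) (j : nat) : A := nth 0 (map arr (word p)) j.

Definition bdz_d n (x : bdz n.+1) : bdz n :=
  \sum_t x t *: let: (b, p, b') := val t in
    btens (bas b * parr (qp p) 0) (kpath n (subp (qp p) 1 n)) (bas b')
    + (-1) ^+ n.+1 *:
      btens (bas b) (kpath n (subp (qp p) 0 n)) (parr (qp p) n * bas b').

Definition cmpF n (x : bdz n) : bar n :=
  \sum_t x t *: let: (b, p, b') := val t in
    tens n (nth 0 (bas b :: rcons (map arr (word (qp p))) (bas b'))).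

Definition cmpG n (x : bar n) : bdz n :=
  \sum_b x b *: btens (bfac b 0) (concat n (fun j => bfac b j.+1)) (bfac b n.+1).

(* Extended left A-linearly from the elements 1 (x) x, with
   x in (rad A)^{(x)_E n} (x)_E A. *)
Fixpoint cmpH (n : nat) : bar n -> bar n.+1 :=
  match n with
  | 0 => fun _ => 0
  | m.+1 => fun y => \sum_b y b *: bar_lact (bfac b 0)
      (let ux := tens m.+1 (fun j => if j == 0%N then 1 else bfac b j) in
       bar_s (cmpF (cmpG ux)) - bar_s (cmpH (bar_d ux)))
  end.

(* An element of Hom_{E-E}(k AP_n, A), or of Hom_{E-E}((rad A)^{(x)_E n}, A)
   since the tensors alpha_1 (x) ... (x) alpha_n with alpha_1 ... alpha_n a path
   form a basis of (rad A)^{(x)_E n}, is given by its values on paths of length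
   n. A cochain here is a family of values on all paths, that is an element of
   the product over n of these spaces (if it satisfies ebimod). *)
Definition cochain := qpath Q -> A.

Definition ebimod (f : cochain) : Prop :=
  forall p, f p = idem (start p) * f p * idem (finish p).

(* Degree i of the complexes shifted by 1: cochains on paths of length i + 1. *)
Definition cdeg (i : int) (f : cochain) : Prop :=
  ebimod f /\ (forall p, (len p)%:Z != i + 1 -> f p = 0).

(* f(a_1 (x) ... (x) a_n), extended by zero when an argument lies in E. *)
Definition ceval n (f : cochain) (a : nat -> A) : A :=
  \sum_(p : AP Q n) concat n a p *: f (qp p).

(* \hat f, on A (x)_E (rad A)^{(x)_E n} (x)_E A and A (x)_E k AP_n (x)_E A *)
Definition bar_hat n (f : cochain) (x : bar n) : A :=
  \sum_b x b *: (bfac b 0 * ceval n f (fun j => bfac b j.+1) * bfac b n.+1).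
Definition bdz_hat n (f : cochain) (x : bdz n) : A :=
  \sum_t x t *: let: (b, p, b') := val t in bas b * f (qp p) * bas b'.

(* 1 (x) p (x) 1 for a path p of length n. In the first case it is written
   e_{s(p)} (x) alpha_1 (x) ... (x) alpha_n (x) 1, which is also correct for
   n = 0, where p = e_{s(p)} lies in E. *)
Definition bar_gen n (p : qpath Q) : bar n :=
  tens n (nth 1 (idem (start p) :: map arr (word p))).
Definition bdz_gen n (p : qpath Q) : bdz n := btens 1 (kpath n p) 1.

Definition bar_diff (f : cochain) : cochain := fun p =>
  if len p is n.+1 then (-1) ^+ n *: bar_hat f (bar_d (bar_gen n.+1 p)) else 0.
Definition bdz_delta (f : cochain) : cochain := fun p =>
  if len p is n.+1 then bdz_hat f (bdz_d (bdz_gen n.+1 p)) else 0.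
Definition bdz_diff (f : cochain) : cochain := fun p =>
  (-1) ^+ (len p).-1 *: bdz_delta f p.

(* F^*, G^* and H^*, in all degrees *)
Definition Fstar (f : cochain) : cochain := fun p =>
  bar_hat f (cmpF (bdz_gen (len p) p)).
Definition Gstar (f : cochain) : cochain := fun p =>
  bdz_hat f (cmpG (bar_gen (len p) p)).
Definition Hstar (f : cochain) : cochain := fun p =>
  (-1) ^+ len p *: bar_hat f (cmpH (bar_gen (len p) p)).

(* The Gerstenhaber bracket of f and g of unshifted degrees n and m *)
Definition circ (n m : nat) (f g : cochain) : cochain := fun p =>
  if (len p).+1 == (n + m)%N then
    \sum_(i < n) (-1) ^+ (i * m.+1) *:
      ceval n f (fun j => if (j < i)%N then parr p j
                          else if j == i then g (subp p i m)
                          else parr p (j + m).-1)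
  else 0.
Definition sgn (z : int) : k := (-1) ^ z.
Definition gbr (n m : nat) (f g : cochain) : cochain :=
  circ n m f g - sgn ((n%:Z - 1) * (m%:Z - 1)) *: circ m n g f.

(* The unshifted degree; the cochains of shifted degree i < -1 are 0. *)
Definition unshift (i : int) : nat := if (i + 1)%R is Posz n then n else 0%N.
Definition sbr (i j : int) : cochain -> cochain -> cochain :=
  gbr (unshift i) (unshift j).

End Complexes.

(* A family (V^i) of subspaces of an ambient space, with operations defined on
   homogeneous elements of given degrees *)
Record dgl_data (k : fieldType) := DglData {
  dgl_car : lmodType k;
  dgl_deg : int -> dgl_car -> Prop;
  dgl_d : int -> dgl_car -> dgl_car;
  dgl_br : int -> int -> dgl_car -> dgl_car -> dgl_car }.

Section DgLie.
Variable k : fieldType.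

Record is_dgLie (L : dgl_data k) : Prop := IsDgLie {
  dgl_deg0 : forall i, dgl_deg i (0 : dgl_car L);
  dgl_degP : forall i (c : k) (x y : dgl_car L),
    dgl_deg i x -> dgl_deg i y -> dgl_deg i (c *: x + y);
  dgl_d_deg : forall i (x : dgl_car L),
    dgl_deg i x -> dgl_deg (i + 1) (dgl_d i x);
  dgl_d_lin : forall i (c : k) (x y : dgl_car L),
    dgl_deg i x -> dgl_deg i y ->
    dgl_d i (c *: x + y) = c *: dgl_d i x + dgl_d i y;
  dgl_br_deg : forall i j (x y : dgl_car L),
    dgl_deg i x -> dgl_deg j y -> dgl_deg (i + j) (dgl_br i j x y);
  dgl_br_linl : forall i j (c : k) (x x' y : dgl_car L),
    dgl_deg i x -> dgl_deg i x' -> dgl_deg j y ->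
    dgl_br i j (c *: x + x') y = c *: dgl_br i j x y + dgl_br i j x' y;
  dgl_br_linr : forall i j (c : k) (x y y' : dgl_car L),
    dgl_deg i x -> dgl_deg j y -> dgl_deg j y' ->
    dgl_br i j x (c *: y + y') = c *: dgl_br i j x y + dgl_br i j x y';
  dgl_dd : forall i (x : dgl_car L),
    dgl_deg i x -> dgl_d (i + 1) (dgl_d i x) = 0;
  dgl_antisym : forall i j (x y : dgl_car L),
    dgl_deg i x -> dgl_deg j y ->
    dgl_br i j x y = - (sgn k (i * j) *: dgl_br j i y x);
  dgl_leibniz : forall i j (x y : dgl_car L),
    dgl_deg i x -> dgl_deg j y ->
    dgl_d (i + j) (dgl_br i j x y) =
    dgl_br (i + 1) j (dgl_d i x) y + sgn k i *: dgl_br i (j + 1) x (dgl_d j y);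
  dgl_jacobi : forall i j l (x y z : dgl_car L),
    dgl_deg i x -> dgl_deg j y -> dgl_deg l z ->
    dgl_br i (j + l) x (dgl_br j l y z) =
    dgl_br (i + j) l (dgl_br i j x y) z
    + sgn k (i * j) *: dgl_br j (i + l) y (dgl_br i l x z) }.

Record dgLie_morphism (L M : dgl_data k) (phi : dgl_car L -> dgl_car M) : Prop :=
  DgLieMorphism {
  dglm_deg : forall i x, dgl_deg i x -> dgl_deg i (phi x);
  dglm_lin : forall i (c : k) x y, dgl_deg i x -> dgl_deg i y ->
    phi (c *: x + y) = c *: phi x + phi y;
  dglm_d : forall i x, dgl_deg i x -> phi (dgl_d i x) = dgl_d i (phi x);
  dglm_br : forall i j x y, dgl_deg i x -> dgl_deg j y ->
    phi (dgl_br i j x y) = dgl_br i j (phi x) (phi y) }.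

Definition cocycle (L : dgl_data k) i (x : dgl_car L) : Prop :=
  dgl_deg i x /\ dgl_d i x = 0.
Definition coboundary (L : dgl_data k) i (x : dgl_car L) : Prop :=
  exists2 y, dgl_deg (i - 1) y & x = dgl_d (i - 1) y.

(* The map induced in cohomology is injective and surjective. *)
Record dgLie_quasi_iso (L M : dgl_data k) (phi : dgl_car L -> dgl_car M) : Prop :=
  DgLieQuasiIso {
  dglq_source : is_dgLie L;
  dglq_target : is_dgLie M;
  dglq_morphism : dgLie_morphism phi;
  dglq_inj : forall i x, cocycle i x -> coboundary i (phi x) -> coboundary i x;
  dglq_surj : forall i z, cocycle i z ->
    exists2 x, cocycle i x & coboundary i (z - phi x) }.

(* The degree 1 elements sum_(i >= 1) f_i t^i of L (x) (t) such that
   d f + 1/2 [f, f] = 0 *)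
Definition MC (L : dgl_data k) : set (nat -> dgl_car L) :=
  [set f | [/\ f 0%N = 0, forall i, dgl_deg 1 (f i) &
    forall i, dgl_d 1 (f i)
      + 2%:R^-1 *: \sum_(j < i.+1) dgl_br 1 1 (f j) (f (i - j)%N) = 0]]%classic.

End DgLie.
Arguments MC {k} L.

Section Linfty.
Variables (k : fieldType) (Q : quiver).
Local Notation V := (cochain k Q).

(* Lists of homogeneous elements x_1, ..., x_n, each with its degree *)
Definition hseq := seq (int * V).
Definition homogeneous (xs : hseq) : Prop := forall x, x \in xs -> cdeg x.1 x.2.
Definition degs (xs : hseq) : int := \sum_(x <- xs) x.1.
Definition hnth (xs : hseq) (i : nat) : int * V := nth (0, 0) xs i.

Definition hperm n (tau : 'S_n) (xs : hseq) : hseq :=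
  [seq hnth xs (tau i) | i <- enum 'I_n].

(* Koszul sign: x_1 /\ ... /\ x_n = epsilon x_tau(1) /\ ... /\ x_tau(n) *)
Definition epsilon n (tau : 'S_n) (xs : hseq) : k :=
  \prod_(i < n) \prod_(j < n | (i < j)%N && (tau j < tau i)%N)
    sgn k ((hnth xs (tau i)).1 * (hnth xs (tau j)).1).
Definition chi n (tau : 'S_n) (xs : hseq) : k := (-1) ^+ tau * epsilon tau xs.
Definition kappa n (t : nat) (tau : 'S_n) (xs : hseq) : k :=
  sgn k ((t%:Z - 1) + (n%:Z - t%:Z - 1) * degs (take t (hperm tau xs))).

(* S_{t,n-t} and S^-_{t,n-t} *)
Definition shuffle n (t : nat) (tau : 'S_n) : bool :=
  [forall i : 'I_n, forall j : 'I_n,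
    (i < j)%N && ((j < t)%N || (t <= i)%N) ==> (tau i < tau j)%N].
Definition shuffle_minus n (t : nat) (tau : 'S_n) : bool :=
  shuffle t tau &&
  [forall i : 'I_n, forall j : 'I_n,
    (i == 0%N :> nat) && (j == t :> nat) ==> (tau i < tau j)%N].

Definition ophom := hseq -> V.

Definition hhom (f : V) : V := - Hstar f.
Definition linf_l1 (f : V) : V := - bdz_diff f.

(* phi n is of degree 1 - n and l n of degree 2 - n. *)
Definition linf_v (phi : nat -> ophom) (n : nat) : ophom := fun xs =>
  \sum_(1 <= t < n) \sum_(tau : 'S_n | shuffle_minus t tau)
    (chi tau xs * kappa t tau xs) *:
    let ys := take t (hperm tau xs) in
    let zs := drop t (hperm tau xs) in
    sbr (degs ys + 1 - t%:Z) (degs zs + 1 - (n - t)%N%:Z)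
      (phi t ys) (phi (n - t)%N zs).

Definition linf_l_of (phi : nat -> ophom) (n : nat) : ophom := fun xs =>
  match n with
  | 0 => 0
  | 1 => linf_l1 (hnth xs 0).2
  | _ => Fstar (linf_v phi n xs)
  end.

Definition linf_u (phi : nat -> ophom) (n : nat) : ophom := fun xs =>
  \sum_(2 <= m < n.+1) \sum_(tau : 'S_n | shuffle m tau)
    (sgn k (m%:Z * (n%:Z - m%:Z) + 1) * chi tau xs) *:
    let ys := take m (hperm tau xs) in
    phi (n - m).+1
      ((degs ys + 2 - m%:Z, linf_l_of phi m ys) :: drop m (hperm tau xs)).

(* linf_phi_upto m is correct on the indices at most m. *)
Fixpoint linf_phi_upto (m n : nat) : ophom :=
  match m with
  | 0 => fun _ => 0
  | m'.+1 =>
    if n == m'.+1 then fun xs =>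
      if n == 1%N then Gstar (hnth xs 0).2
      else hhom (linf_u (linf_phi_upto m') n xs + linf_v (linf_phi_upto m') n xs)
    else linf_phi_upto m' n
  end.

Definition linf_phi (n : nat) : ophom := linf_phi_upto n n.
Definition linf_l : nat -> ophom := linf_l_of linf_phi.

Lemma linf_phi_uptoS m n : linf_phi_upto m.+1 n =
  if n == m.+1 then fun xs =>
    if n == 1%N then Gstar (hnth xs 0).2
    else hhom (linf_u (linf_phi_upto m) n xs + linf_v (linf_phi_upto m) n xs)
  else linf_phi_upto m n.
Proof. exact: erefl. Qed.

Lemma linf_phi_uptoE m n : (n <= m)%N -> linf_phi_upto m n = linf_phi n.
Proof.
elim: m => [|m IH]; first by rewrite leqn0 => /eqP ->.
rewrite leq_eqVlt => /orP[/eqP ->//|h].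
by rewrite linf_phi_uptoS ltn_eqF // IH.
Qed.

Lemma linf_v_ext phi psi n xs :
  (forall t, (t < n)%N -> phi t = psi t) -> linf_v phi n xs = linf_v psi n xs.
Proof.
move=> e; rewrite /linf_v; apply: eq_big_nat => t /andP[t1 tn].
apply: eq_bigr => tau _; congr (_ *: _).
by rewrite !e // ltn_subrL t1 (leq_trans _ tn).
Qed.

Lemma linf_l_of_ext phi psi m xs :
  (forall t, (t < m)%N -> phi t = psi t) -> linf_l_of phi m xs = linf_l_of psi m xs.
Proof.
case: m => [|[|m]] e; [reflexivity | reflexivity | ].
by rewrite /linf_l_of (linf_v_ext _ e).
Qed.

Lemma linf_phi1 xs : linf_phi 1 xs = Gstar (hnth xs 0).2.
Proof. by rewrite /linf_phi linf_phi_uptoS. Qed.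

Lemma linf_phiE n xs : (1 < n)%N ->
  linf_phi n xs = hhom (linf_u linf_phi n xs + linf_v linf_phi n xs).
Proof.
case: n => [|n] // n1; have n0 : n.+1 != 1%N by rewrite gtn_eqF.
rewrite [LHS]/linf_phi linf_phi_uptoS eqxx (negbTE n0).
have -> : linf_v (linf_phi_upto n) n.+1 xs = linf_v linf_phi n.+1 xs.
  by apply: linf_v_ext => t; rewrite ltnS => /linf_phi_uptoE.
suff -> : linf_u (linf_phi_upto n) n.+1 xs = linf_u linf_phi n.+1 xs by [].
rewrite /linf_u; apply: eq_big_nat => m /andP[m2 mn]; apply: eq_bigr => tau _.
rewrite linf_phi_uptoE; last first.
  by case: m m2 {mn} => [|[|m]] // _; rewrite subSS ltn_subrL.
rewrite (linf_l_of_ext (psi := linf_phi)); first reflexivity.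
by move=> t tm; apply: linf_phi_uptoE; rewrite -ltnS (leq_trans tm).
Qed.

Definition hoch_dgl : dgl_data k :=
  @DglData k V (@cdeg k Q) (fun _ f => - bar_diff f) (@sbr k Q).
Definition bdz_dgl : dgl_data k :=
  @DglData k V (@cdeg k Q) (fun i f => linf_l 1 [:: (i, f)])
    (fun i j f g => linf_l 2 [:: (i, f); (j, g)]).

(* \hat f (G_2 (1 (x) x_r (x) y_r (x) 1)) *)
Definition evalG2 (f : V) (x y : rsz k Q) : rsz k Q :=
  bdz_hat f (cmpG (tens 2 (nth 0 [:: 1; radp x; radp y; 1]))).

End Linfty.

(* Main.v *)
Require Import Defs.
From HB Require Import structures.
From mathcomp Require Import all_boot all_order all_algebra all_fingroup.
From mathcomp Require Import boolp classical_sets functions ring zify.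
Import GRing.Theory.
Local Open Scope ring_scope.
Set Implicit Arguments.
Unset Strict Implicit.
Unset Printing Implicit Defensive.

(** Because [rad A] squares to zero, the tensors of composable arrows are at
    the same time a basis of [(rad A)^{(x)_E n}] and of [k AP_n], and in both
    differentials only the two outer terms survive, an inner term containing a
    product of two arrows.  So [F] and [G] are inverse isomorphisms of
    resolutions, and on bimodule cochains [F^*] and [G^*] are the identity
    ([Fstar_id], [Gstar_id]) and the two differentials coincide
    ([bdz_diff_bar]).

    The homotopy vanishes ([cmpH0]): [s] replaces the first factor by its
    radical part, while [F] and [G] keep a first factor [1] in [E].  Hence
    [phi_n = h (u_n + v_n)] is zero for [n >= 2].  In [v_n] with [n >= 3], each
    bracket [[phi_t, phi_(n-t)]] has an index at least [2], so [v_n], and with it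
    [l_n = F^* v_n], is zero ([linf_l_ge3]); and [l_2] is the Gerstenhaber bracket
    ([linf_l2]).  On homogeneous elements [B^*(A)[1]] therefore is
    [C^*(A)[1]], with [G^*] the identity, which settles the quasi-isomorphism
    and the bijection between the sets of Maurer-Cartan elements.

    What remains is that [C^*(A)[1]] is a dg-Lie algebra.  A cochain [f] is
    encoded by the noncommutative power series [f_b], one for each path [b] of
    length at most [1], that collect the coefficients of [b] in the values of
    [f] on words in the paths of length at most [1]; vertices are admitted as
    letters, although the series of a cochain only involve arrows.  Then
    [f o g] is obtained by applying to each [f_b] the graded derivation
    [D_g] that sends the variable [X_a] to [g_a] ([circ_series_of]), and the
    pre-Lie identity for [o] says that a graded commutator of derivations is
    the derivation determined by its values on the variables
    ([der_commutator]); the Jacobi identity follows formally ([lie_br_jacobi]).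
    The multiplication of [A] is itself a family of quadratic series [mu], which
    does involve the vertex variables.  Associativity is [[mu, mu] = 0]
    ([mu_mu]), and the differential of [C^*(A)[1]] is [[mu, -]] ([hoch_dE]): on a
    series supported on paths from [v] to [v'], the terms that [D_mu] creates
    inside a path cancel in pairs, leaving one at each end ([der_mu]).  The
    Leibniz rule and [d d = 0] are then instances of the Jacobi identity.

    In the Maurer-Cartan equation, a sum [[f_j, f_k] + [f_k, f_j]] is twice
    [f_j o f_k + f_k o f_j] in degree [1], which absorbs the factor [1/2]
    ([MC_circ]); evaluation on the paths of length [3] gives the explicit
    equations. *)

(** * Noncommutative power series and their graded derivations *)

Definition series (k : fieldType) (T : finType) := seq T -> k.
HB.instance Definition _ (k : fieldType) (T : finType) :=
  GRing.Lmodule.copy (series k T) (seq T -> k^o).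

Section Series.
Variables (k : fieldType) (T : finType).
Local Notation series := (series k T).
Implicit Types (P K L : series) (a b x : T) (w u v : seq T) (s t e c : k).

Lemma serD P K w : (P + K) w = P w + K w. Proof. by []. Qed.
Lemma serN P w : (- P) w = - P w. Proof. by []. Qed.
Lemma ser0 w : (0 : series) w = 0. Proof. by []. Qed.
Lemma serZ c P w : (c *: P) w = c * P w. Proof. by []. Qed.
Lemma ser_sum (I : Type) (r : seq I) (C : pred I) (F : I -> series) w :
  (\sum_(i <- r | C i) F i) w = \sum_(i <- r | C i) F i w.
Proof. by elim/big_rec2: _ => // i y1 y2 _ <-. Qed.
Definition serE := (serD, serN, ser0, serZ, ser_sum).

Definition smul P K : series :=
  fun w => \sum_(i < (size w).+1) P (take i w) * K (drop i w).
Definition sone : series := fun w => (w == [::])%:R.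
(** With the convolution product, [lquot x] behaves like a one-sided
    derivative ([lquotM]); it makes structural induction on the word at which
    series are compared possible. *)
Definition lquot x P : series := fun w => P (x :: w).

Lemma smul_nil P K : smul P K [::] = P [::] * K [::].
Proof. by rewrite /smul big_ord1. Qed.

Lemma smul_cons P K x w :
  smul P K (x :: w) = P [::] * K (x :: w) + smul (lquot x P) K w.
Proof. by rewrite /smul big_ord_recl. Qed.

Fact smulDl : left_distributive smul +%R.
Proof.
move=> P K L; apply: funext => w; rewrite serD -big_split /=.
by apply: eq_bigr => i _; rewrite serD mulrDl.
Qed.
Fact smulDr : right_distributive smul +%R.
Proof.
move=> P K L; apply: funext => w; rewrite serD -big_split /=.
by apply: eq_bigr => i _; rewrite serD mulrDr.
Qed.
Fact smulZl c P K : smul (c *: P) K = c *: smul P K.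
Proof.
apply: funext => w; rewrite serZ /smul big_distrr; apply: eq_bigr => i _ /=.
by rewrite serZ mulrA.
Qed.
Fact smulZr c P K : smul P (c *: K) = c *: smul P K.
Proof.
apply: funext => w; rewrite serZ /smul big_distrr; apply: eq_bigr => i _ /=.
by rewrite serZ mulrCA.
Qed.

Fact lquot_smul x P K :
  lquot x (smul P K) = P [::] *: lquot x K + smul (lquot x P) K.
Proof. by apply: funext => w; rewrite /lquot smul_cons. Qed.

Fact smulA : associative smul.
Proof.
move=> P K L; apply: funext => w; elim: w P => [|x w IH] P.
  by rewrite !smul_nil mulrA.
rewrite [LHS]smul_cons [RHS]smul_cons lquot_smul smulDl smulZl serD serZ -IH.
by rewrite smul_cons smul_nil; ring.
Qed.
Fact smul1l : left_id sone smul.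
Proof.
move=> P; apply: funext => w; rewrite /smul big_ord_recl take0 drop0 mul1r.
rewrite big1 ?addr0 // => i _; rewrite /sone -size_eq0 size_takel ?mul0r //.
exact: ltn_ord.
Qed.
Fact smul1r : right_id sone smul.
Proof.
move=> P; apply: funext => w; rewrite /smul big_ord_recr /= take_size drop_size mulr1.
rewrite big1 ?add0r // => i _.
by rewrite /sone -size_eq0 size_drop subn_eq0 leqNgt ltn_ord mulr0.
Qed.
HB.instance Definition _ := GRing.Zmodule_isPzRing.Build series
  smulA smul1l smul1r smulDl smulDr.

Lemma serM_nil P K : (P * K) [::] = P [::] * K [::].
Proof. exact: smul_nil. Qed.
Lemma serM_cons P K x w :
  (P * K) (x :: w) = P [::] * K (x :: w) + (lquot x P * K) w.
Proof. exact: smul_cons. Qed.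
Lemma serZl c P K : (c *: P) * K = c *: (P * K). Proof. exact: smulZl. Qed.
Lemma serZr c P K : P * (c *: K) = c *: (P * K). Proof. exact: smulZr. Qed.

Lemma lquotD x P K : lquot x (P + K) = lquot x P + lquot x K. Proof. by []. Qed.
Lemma lquotZ x c P : lquot x (c *: P) = c *: lquot x P. Proof. by []. Qed.
Lemma lquotM x P K : lquot x (P * K) = P [::] *: lquot x K + lquot x P * K.
Proof. exact: lquot_smul. Qed.

Definition var a : series := fun w => (w == [:: a])%:R.
(** For [s = -1] this is the grading automorphism: the sign that appears when
    an operator of sign [s] is moved past [P]. *)
Definition twist s P : series := fun w => s ^+ size w * P w.

Lemma lquot_twist x s P : lquot x (twist s P) = s *: twist s (lquot x P).
Proof. by apply: funext => w; rewrite serZ /lquot /twist /= exprS mulrA. Qed.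

Lemma lquot_var x a : lquot x (var a) = (x == a)%:R *: (1 : series).
Proof.
apply: funext => w; rewrite serZ /lquot /var eqseq_cons.
by rewrite -natrM mulnb.
Qed.

Definition dhead (G : T -> series) P : series := \sum_a G a * lquot a P.

(** The unique [s]-graded derivation with [X_a |-> G a] (see [derM] and
    [der_var]).  The summand [dhead] replaces the first letter of a
    monomial; the recursive call replaces a later one, and [s] is the sign of
    moving past the first letter. *)
Fixpoint der s (G : T -> series) P w : k :=
  dhead G P w + if w is x :: w' then s * der s G (lquot x P) w' else 0.

Local Notation D s G P := (der s G P : series).

Lemma der_nil s G P : der s G P [::] = dhead G P [::].
Proof. exact: addr0. Qed.

Lemma lquot_der x s G P :
  lquot x (D s G P) = lquot x (dhead G P) + s *: D s G (lquot x P).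
Proof. by []. Qed.

Lemma dhead_lin G c P K : dhead G (c *: P + K) = c *: dhead G P + dhead G K.
Proof.
rewrite /dhead scaler_sumr -big_split; apply: eq_bigr => a _.
by rewrite lquotD lquotZ mulrDr serZr.
Qed.

Lemma dhead_linl G H c P :
  dhead (fun a => c *: G a + H a) P = c *: dhead G P + dhead H P.
Proof.
rewrite /dhead scaler_sumr -big_split; apply: eq_bigr => a _.
by rewrite mulrDl serZl.
Qed.

Lemma der_lin s G c P K : D s G (c *: P + K) = c *: D s G P + D s G K.
Proof.
apply: funext => w; elim: w P K => [|x w IH] P K.
  by rewrite serD serZ !der_nil dhead_lin.
rewrite serD serZ /= lquotD lquotZ IH dhead_lin !serE; ring.
Qed.

Lemma der_linl s G H c P :
  D s (fun a => c *: G a + H a) P = c *: D s G P + D s H P.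
Proof.
apply: funext => w; elim: w P => [|x w IH] P.
  by rewrite serD serZ !der_nil dhead_linl.
rewrite serD serZ /= IH dhead_linl !serE; ring.
Qed.

Lemma der0 s G : D s G 0 = 0.
Proof.
by have := der_lin s G (-1) 0 0; rewrite scaler0 addr0 scaleN1r addNr.
Qed.
Lemma derZ s G c P : D s G (c *: P) = c *: D s G P.
Proof. by have := der_lin s G c P 0; rewrite der0 !addr0. Qed.
Lemma derD s G P K : D s G (P + K) = D s G P + D s G K.
Proof. by have := der_lin s G 1 P K; rewrite !scale1r. Qed.
Lemma der_sum s G (I : Type) (r : seq I) (C : pred I) (F : I -> series) :
  D s G (\sum_(i <- r | C i) F i) = \sum_(i <- r | C i) D s G (F i).
Proof.
elim/big_rec2: _ => [|i y1 y2 _ <-]; [exact: der0 | exact: derD].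
Qed.

Lemma dheadM G P K : dhead G (P * K) = P [::] *: dhead G K + dhead G P * K.
Proof.
rewrite /dhead scaler_sumr mulr_suml -big_split; apply: eq_bigr => a _.
by rewrite lquotM mulrDr serZr mulrA.
Qed.

Lemma derM s G P K : D s G (P * K) = D s G P * K + twist s P * D s G K.
Proof.
apply: funext => w; elim: w P K => [|x w IH] P K.
  by rewrite serD !serM_nil !der_nil dheadM serD serZ serM_nil /twist /=; ring.
rewrite [LHS]/= dheadM lquotM der_lin !serE IH !serM_cons.
rewrite der_nil lquot_der lquot_twist [(_ + s *: _ : series) * K]mulrDl !serZl !serE.
rewrite /= /twist /=; ring.
Qed.

Lemma der1 s G : D s G 1 = 0.
Proof.
have d0 : dhead G 1 = 0.
  by apply: big1 => a _; have -> : lquot a 1 = 0 by []; rewrite mulr0.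
apply: funext => -[|x w]; rewrite /= d0 ?addr0 //.
have -> : lquot x 1 = 0 by [].
by rewrite der0 mulr0 addr0.
Qed.

Lemma der_var s G a : D s G (var a) = G a.
Proof.
have dE : dhead G (var a) = G a.
  rewrite /dhead (bigD1 a) //= big1 => [|b nb].
    by rewrite lquot_var eqxx scale1r mulr1 addr0.
  by rewrite lquot_var (negbTE nb) scale0r mulr0.
apply: funext => -[|x w]; rewrite /= dE ?addr0 //.
by rewrite lquot_var derZ der1 scaler0 mulr0 addr0.
Qed.

(** The terms of [D_H (D_G P)] where [H] acts inside the inserted [G] are
    separated from those where it acts elsewhere.  Among the latter, the two sums
    are exchanged, up to the factor [e], when [(H, s)] and [(G, t)] are, and
    the last term is the same expression on a shorter word: this is what the
    commutator formula needs. *)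
Lemma der_der s t e G H P w :
  (forall a, twist s (G a) = (s * e) *: G a) ->
  der s H (D t G P) w =
    dhead (fun a => D s H (G a)) P w
    + t * (\sum_a H a * D t G (lquot a P)) w
    + e * s * (\sum_a G a * D s H (lquot a P)) w
    + if w is x :: w' then s * t * der s H (D t G (lquot x P)) w' else 0.
Proof.
move=> hG.
have hd : dhead H (D t G P) = dhead H (dhead G P) + t *: \sum_a H a * D t G (lquot a P).
  rewrite /dhead scaler_sumr -big_split; apply: eq_bigr => a _.
  by rewrite lquot_der mulrDr serZr.
have dh : D s H (dhead G P) = dhead (fun a => D s H (G a)) P
     + (s * e) *: \sum_a G a * D s H (lquot a P).
  rewrite {1}/dhead der_sum /dhead scaler_sumr -big_split; apply: eq_bigr => a _.
  by rewrite derM hG serZl.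
have /(congr1 (fun F : series => F w)) := dh.
case: w => [|x w]; rewrite !serD !serZ.
  by rewrite !der_nil hd !serD serZ => ->; ring.
rewrite /= hd lquot_der addrC derD derZ !serD !serZ => E.
(* [dh] trades the action of [H] on the first letter for its action on the
   remaining ones. *)
rewrite [s * (_ + _)]mulrDr (canRL (addrK _) E); ring.
Qed.

(** A graded commutator of derivations is a derivation, hence determined by
    its values on the variables.  For series of cochains this is the graded
    pre-Lie identity of the Gerstenhaber product; [e] is the sign of exchanging
    [G] and [H], and the two hypotheses say that [G] and [H] are homogeneous of
    degrees compatible with [s], [t] and [e]. *)
Lemma der_commutator s t e G H P : e * e = 1 ->
  (forall a, twist s (G a) = (s * e) *: G a) ->
  (forall a, twist t (H a) = (t * e) *: H a) ->
  D s H (D t G P) - e *: D t G (D s H P) =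
  D (s * t) (fun a => D s H (G a) - e *: D t G (H a)) P.
Proof.
move=> ee hG hH.
have -> : (fun a => D s H (G a) - e *: D t G (H a)) =
    fun a => (-e) *: D t G (H a) + D s H (G a).
  by apply: funext => a; rewrite scaleNr addrC.
have es : e = 1 \/ e = -1.
  by move/eqP: ee; rewrite -expr2 sqrf_eq1 => /orP[] /eqP ->; [left | right].
apply: funext => w; elim: w P => [|x w IH] P.
  rewrite serD serN serZ (der_der _ _ _ _ hG) (der_der _ _ _ _ hH) der_nil.
  by rewrite dhead_linl serD serZ; case: es => ->; ring.
rewrite serD serN serZ (der_der _ _ _ _ hG) (der_der _ _ _ _ hH).
have := IH (lquot x P); rewrite serD serN serZ => E.
rewrite /= -E dhead_linl serD serZ; case: es => ->; ring.
Qed.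
End Series.

(** * The graded Lie algebra of families of power series *)

Section Sgn.
Variable k : fieldType.
Implicit Types i j : int.

Lemma sgnD i j : sgn k (i + j) = sgn k i * sgn k j.
Proof. by rewrite /sgn expfzDr // oppr_eq0 oner_eq0. Qed.

Lemma sgn_pm i : sgn k i = 1 \/ sgn k i = -1.
Proof.
have h n : (-1) ^+ n = 1 :> k \/ (-1) ^+ n = -1 :> k.
  by rewrite -signr_odd; case: odd; [right | left]; rewrite ?expr1.
rewrite /sgn; case: i => n; first exact: h.
have -> : (-1) ^ Negz n = (-1) ^- n.+1 :> k by [].
case: (h n.+1) => ->; [left | right].
  by rewrite invr1.
by rewrite invrN1.
Qed.

Lemma sgn_sqr i : sgn k i * sgn k i = 1.
Proof. by case: (sgn_pm i) => ->; rewrite ?mulrNN mulr1. Qed.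

Lemma sgnX i n : sgn k i ^+ n = sgn k (i * n%:Z).
Proof. by rewrite /sgn -exprz_exp. Qed.
End Sgn.

Section Families.
Variables (k : fieldType) (T : finType).
Local Notation series := (series k T).
Local Notation D s G P := (der s G P : series).
Implicit Types (F G H : T -> series) (P K : series) (i j l : int).

Lemma serM_neq0 P K w : (P * K) w != 0 ->
  exists u v, [/\ w = u ++ v, P u != 0 & K v != 0].
Proof.
elim: w P => [|x w IH] P.
  by rewrite serM_nil mulf_eq0 negb_or => /andP[]; exists [::], [::].
rewrite serM_cons; have [-> /[1!add0r]/IH[u [v [-> hu hv]]]|h _] := eqVneq (P [::] * K (x :: w)) 0.
  by exists (x :: u), v.
by exists [::], (x :: w); split=> //; apply: contraNneq h => ->; rewrite ?mul0r ?mulr0.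
Qed.

Lemma sum_neq0 (I : finType) (F : I -> k) : \sum_x F x != 0 -> exists x, F x != 0.
Proof.
move=> h; apply/existsP; apply: contraR h; rewrite negb_exists => /forallP h.
by rewrite big1 // => x _; apply/eqP; move: (h x); rewrite negbK.
Qed.

(** The monomials that occur in [D_G P] are monomials of [P] with one letter
    replaced by a monomial of [G].  Degrees and supports of derivatives are
    read off from this. *)
Lemma der_neq0 s G P w : der s G P w != 0 ->
  exists a u v u', [/\ w = u ++ v ++ u', G a v != 0 & P (u ++ a :: u') != 0].
Proof.
elim: w P => [|x w IH] P /=.
  rewrite addr0 /dhead ser_sum => /sum_neq0[a /serM_neq0[v [u [e hG hP]]]].
  by exists a, [::], v, u.
have [->|] := eqVneq (dhead G P (x :: w)) 0.
  rewrite add0r mulf_eq0 negb_or => /andP[_ /IH[a [u [v [u' [-> hG hP]]]]]].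
  by exists a, (x :: u), v, u'.
rewrite /dhead ser_sum => /sum_neq0[a /serM_neq0[v [u [e hG hP]]]] _.
by exists a, [::], v, u.
Qed.

(** The degree is shifted: a cochain of arity [n] has degree [n - 1], which is
    also the degree of its derivation. *)
Definition homog i F := forall b w, F b w != 0 -> (size w)%:Z = i + 1.

(** The Gerstenhaber bracket [F o G - (-1)^(ij) G o F]. *)
Definition lie_br i j F G : T -> series := fun b =>
  D (sgn k j) G (F b) - sgn k (i * j) *: D (sgn k i) F (G b).

Lemma homog_twist i j F b : homog i F ->
  twist (sgn k j) (F b) = (sgn k j * sgn k (i * j)) *: F b.
Proof.
move=> hF; apply: funext => w; rewrite serZ /twist.
have [->|/hF e] := eqVneq (F b w) 0; first by rewrite !mulr0.
by rewrite sgnX e mulrDr mulr1 addrC sgnD mulrC [j * i]mulrC mulrC.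
Qed.

Lemma homog_lin i c F G : homog i F -> homog i G -> homog i (fun b => c *: F b + G b).
Proof.
move=> hF hG b w; rewrite serD serZ.
have [->|/hG //] := eqVneq (G b w) 0.
by rewrite addr0 mulf_eq0 negb_or => /andP[_ /hF].
Qed.

Lemma homog_der i j F G s : homog i F -> homog j G ->
  homog (i + j) (fun b => D s G (F b)).
Proof.
move=> hF hG b w /der_neq0[a [u [v [u' [-> /hG hv /hF]]]]].
rewrite !size_cat /=; move: hv; lia.
Qed.

Lemma homog_br i j F G : homog i F -> homog j G -> homog (i + j) (lie_br i j F G).
Proof.
move=> hF hG.
have -> : lie_br i j F G = fun b =>
  - sgn k (i * j) *: D (sgn k i) F (G b) + D (sgn k j) G (F b).
  by apply: funext => b; rewrite /lie_br scaleNr addrC.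
by apply: homog_lin; [rewrite addrC|]; apply: homog_der.
Qed.

Lemma lie_br_anti i j F G : lie_br i j F G = fun b => - (sgn k (i * j) *: lie_br j i G F b).
Proof.
apply: funext => b; rewrite /lie_br scalerBr scalerA [j * i]mulrC sgn_sqr scale1r.
by rewrite opprB.
Qed.

Lemma lie_br_linl i j c F F' G :
  lie_br i j (fun b => c *: F b + F' b) G = fun b => c *: lie_br i j F G b + lie_br i j F' G b.
Proof.
apply: funext => b; rewrite /lie_br der_lin der_linl.
by apply: funext => w; rewrite !serE; ring.
Qed.

(** Expressing the derivation of a bracket as a commutator leaves only
    composites of two derivations; in the Jacobi identity, written with nested
    brackets on the right by antisymmetry, they cancel in pairs. *)
Lemma lie_br_br i j l F G H b : homog j G -> homog l H ->
  lie_br i (j + l) F (lie_br j l G H) b =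
  D (sgn k l) H (D (sgn k j) G (F b))
  - sgn k (j * l) *: D (sgn k j) G (D (sgn k l) H (F b))
  - sgn k (i * (j + l)) *: (D (sgn k i) F (D (sgn k l) H (G b))
                      - sgn k (j * l) *: D (sgn k i) F (D (sgn k j) G (H b))).
Proof.
move=> hG hH; rewrite {1}/lie_br; congr (_ - _ *: _); last first.
  by rewrite /lie_br -!scaleNr addrC der_lin addrC.
rewrite (der_commutator (s := sgn k l)) ?sgn_sqr //.
- by rewrite sgnD mulrC.
- by move=> a; apply: homog_twist.
- by move=> a; rewrite (homog_twist _ _ hH) [l * _]mulrC.
Qed.

Lemma lie_br_jacobi i j l F G H : homog i F -> homog j G -> homog l H ->
  lie_br i (j + l) F (lie_br j l G H) = fun b =>
    lie_br (i + j) l (lie_br i j F G) H b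
    + sgn k (i * j) *: lie_br j (i + l) G (lie_br i l F H) b.
Proof.
move=> hF hG hH; apply: funext => b; rewrite [in RHS]lie_br_anti !lie_br_br //.
apply: funext => w; rewrite !serE [l * (i + j)]mulrC !mulrDl !mulrDr !sgnD.
rewrite [j * i]mulrC.
case: (sgn_pm k (i * j)) => ->; case: (sgn_pm k (i * l)) => ->;
  case: (sgn_pm k (j * l)) => ->; ring.
Qed.
End Families.

(** * Cochains as families of power series *)

Section Cochains.
Variables (k : fieldType) (Q : quiver).
Local Notation A := (rsz k Q).
Local Notation B := (basis Q).
Local Notation series := (series k B).
Local Notation D s G P := (der s G P : series).
Local Notation cochain := (cochain k Q).
Implicit Types (f g h : cochain) (p q : qpath Q) (F G : B -> series) (P K : series) (i : int).

Definition letters (s : seq (arrow Q)) : seq B := map inr s.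
Definition arrows (w : seq B) : seq (arrow Q) :=
  pmap (fun b => if b is inr a then Some a else None) w.

Lemma arrowsK s : arrows (letters s) = s.
Proof. by elim: s => //= a s ->. Qed.
Lemma lettersK w : all (@is_arrow Q) w -> letters (arrows w) = w.
Proof. by elim: w => [|[v|a] w IH] //= /IH ->. Qed.
Lemma all_letters s : all (@is_arrow Q) (letters s).
Proof. by elim: s. Qed.

(** Since the coefficient of [b] in [f p] is zero unless [p] starts at the
    source of [b], that source can be taken as the start of the word; this is
    what determines the constant terms, where the word is empty. *)
Definition series_of f : B -> series := fun b w =>
  if all (@is_arrow Q) w then
    if insub (bsrc b, arrows w) is Some p then f p b else 0
  else 0.

Definition cochain_of F : cochain := fun p =>
  [ffun b => if bsrc b == start p then F b (letters (word p)) else 0].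

Lemma series_of_path f b p : bsrc b = start p -> series_of f b (letters (word p)) = f p b.
Proof.
move=> e; rewrite /series_of all_letters arrowsK e.
have -> : (start p, word p) = val p by case: p {e} => -[].
by rewrite valK.
Qed.

Lemma series_of_neq0 f b w : series_of f b w != 0 ->
  exists p, [/\ start p = bsrc b, w = letters (word p) & f p b != 0].
Proof.
rewrite /series_of; case: ifP => [/lettersK {2}<-|_]; last by rewrite eqxx.
case: insubP => [p _ e|_]; last by rewrite eqxx.
by exists p; rewrite /start /word e.
Qed.

Lemma mul_idem (x : A) v b : (x * idem k v) b = x b * (btgt b == v)%:R.
Proof. by case: b => w; rewrite !ffunE /= ?mulr0 ?add0r ?addr0. Qed.
Lemma idem_mul (x : A) v b : (idem k v * x) b = (bsrc b == v)%:R * x b.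
Proof. by case: b => w; rewrite !ffunE /= ?mul0r ?add0r ?addr0. Qed.

(** An element of [Hom_{E-E}] sends a path to a combination of parallel
    paths. *)
Lemma ebimodP f : ebimod f <->
  forall p b, f p b != 0 -> bsrc b = start p /\ btgt b = finish p.
Proof.
split=> [h p b|h p].
  rewrite h mul_idem idem_mul.
  case: (bsrc b =P _) => [->|_]; last by rewrite !mul0r eqxx.
  by case: (btgt b =P _) => [->|_]; last by rewrite mulr0 eqxx.
apply/ffunP => b; rewrite mul_idem idem_mul.
have [->|/h[-> ->]] := eqVneq (f p b) 0; first by rewrite mulr0 mul0r.
by rewrite !eqxx mul1r mulr1.
Qed.

(** The series [P] only involves the monomials of arrows that are paths from
    [v] to [v']; the families with [path_family] are the series of elements of
    [Hom_{E-E}]. *)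
Definition path_supp v v' (P : series) : Prop := forall w, P w != 0 ->
  exists s, [/\ w = letters s, chain v s & chain_end v s = v'].
Definition path_family F := forall b, path_supp (bsrc b) (btgt b) (F b).

Lemma series_of_path_family f : ebimod f -> path_family (series_of f).
Proof.
move/ebimodP=> h b w /series_of_neq0[p [hp -> /h[_ ht]]].
by exists (word p); rewrite -hp ht; split => //; exact: (valP p).
Qed.

Lemma cochain_ofK F : path_family F -> series_of (cochain_of F) = F.
Proof.
move=> h; apply: funext => b; apply: funext => w.
have [e|] := eqVneq (F b w) 0.
  have [-> //|/series_of_neq0[p [hs ew]]] := eqVneq (series_of (cochain_of F) b w) 0.
  by rewrite ffunE -ew e; case: ifP; rewrite eqxx.
move=> /h[s [-> hc _]].
pose p : qpath Q := exist (fun p : vert Q * seq (arrow Q) => chain p.1 p.2) (bsrc b, s) hc.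
rewrite -[s]/(word p) series_of_path // ffunE eqxx //.
Qed.

Lemma ebimod_cochain_of F : path_family F -> ebimod (cochain_of F).
Proof.
move=> h; apply/ebimodP => p b; rewrite ffunE.
case: (bsrc b =P _) => [e|]; last by rewrite eqxx.
move=> /h[s [/(congr1 arrows)]]; rewrite !arrowsK => <- _ <-.
by rewrite /finish e.
Qed.

Lemma series_of_lin c f g : series_of (c *: f + g) = fun b => c *: series_of f b + series_of g b.
Proof.
apply: funext => b; apply: funext => w; rewrite serD serZ /series_of.
case: ifP => _; last by rewrite mulr0 addr0.
case: insub => [p|]; last by rewrite mulr0 addr0.
by rewrite !ffunE.
Qed.

Lemma cochain_of_lin c F G :
  cochain_of (fun b => c *: F b + G b) = c *: cochain_of F + cochain_of G.
Proof.
apply: funext => p; apply/ffunP => b; rewrite !ffunE.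
by case: ifP => _; rewrite ?scaler0 ?addr0.
Qed.

Lemma series_of_homog i f : cdeg i f -> homog i (series_of f).
Proof.
case=> _ h b w /series_of_neq0[p [_ -> hp]]; rewrite size_map.
by apply/eqP; apply: contraR hp => /h ->; rewrite ffunE.
Qed.

Lemma cdeg_cochain_of i F : path_family F -> homog i F -> cdeg i (cochain_of F).
Proof.
move=> hF hi; split; first exact: ebimod_cochain_of.
move=> p hp; apply/ffunP => b; rewrite !ffunE; case: ifP => // _.
by apply/eqP; apply: contraR hp => /hi; rewrite size_map => ->.
Qed.

Lemma chain_cat v (s t : seq (arrow Q)) :
  chain v (s ++ t) = chain v s && chain (chain_end v s) t.
Proof. by elim: s v => //= a s IH v; rewrite IH andbA. Qed.
Lemma chain_end_cat v (s t : seq (arrow Q)) :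
  chain_end v (s ++ t) = chain_end (chain_end v s) t.
Proof. exact: foldl_cat. Qed.
(** A nonempty word determines its start, and an empty one has its start as
    its end. *)
Lemma chain_start v v' (s : seq (arrow Q)) :
  chain v s -> chain v' s -> chain_end v s = chain_end v' s -> v = v'.
Proof. by case: s => //= a s /andP[/eqP <- _] /andP[/eqP <- _]. Qed.

Lemma letters_split u w s : letters s = u ++ w ->
  exists s1 s2, [/\ s = s1 ++ s2, u = letters s1 & w = letters s2].
Proof.
move=> e; exists (take (size u) s), (drop (size u) s).
by rewrite cat_take_drop /letters map_take map_drop -/(letters s) e take_size_cat ?drop_size_cat.
Qed.

Lemma path_suppM v u v' (P K : series) :
  path_supp v u P -> path_supp u v' K -> path_supp v v' (P * K).
Proof.
move=> hP hK w /serM_neq0[w1 [w2 [-> /hP[s [-> c1 e1]] /hK[t [-> c2 e2]]]]].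
exists (s ++ t); rewrite /letters map_cat chain_cat chain_end_cat c1 e1 c2.
by split.
Qed.

Lemma path_supp_lin c v v' (P K : series) :
  path_supp v v' P -> path_supp v v' K -> path_supp v v' (c *: P + K).
Proof.
move=> hP hK w; rewrite serD serZ.
have [->|/hK //] := eqVneq (K w) 0.
by rewrite addr0 mulf_eq0 negb_or => /andP[_ /hP].
Qed.

Lemma path_supp_der s F v v' (P : series) :
  path_family F -> path_supp v v' P -> path_supp v v' (der s F P).
Proof.
move=> hF hP w /der_neq0[b [u [x [u' [-> /hF[t [-> ct et]] /hP[z [ez cz dz]]]]]]].
case/esym/letters_split: ez => z1 [z2 [ez -> e2]].
case: z2 e2 ez => // a z2 [eb ->] ez; rewrite ez in cz dz.
move: cz dz; rewrite chain_cat chain_end_cat /= => /and3P[c1 /eqP c2 c3] d.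
move: ct et; rewrite eb /= c2 => ct et.
exists (z1 ++ t ++ z2); rewrite /letters !map_cat !chain_cat !chain_end_cat c1 ct et c3.
by split.
Qed.

Lemma path_family_br i j F G : path_family F -> path_family G -> path_family (lie_br i j F G).
Proof.
move=> hF hG b; rewrite /lie_br addrC -scaleNr.
by apply: path_supp_lin; apply: path_supp_der.
Qed.

(** The structure constants of [A]: among the products of two basis elements,
    [e_v] is only [e_v e_v], and an arrow [a] only [e_(s(a)) a] and
    [a e_(t(a))]. *)
Definition mu : B -> series := fun b => match b with
  | inl v => var k b * var k b
  | inr a => var k (inl (src a)) * var k b + var k b * var k (inl (tgt a))
  end.

Lemma var_neq0 (b : B) w : var k b w != 0 -> w = [:: b].
Proof. by rewrite /var; case: (w =P _) => // _; rewrite eqxx. Qed.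

Lemma mu_deg : homog 1 mu.
Proof.
have h (b c : B) w : (var k b * var k c) w != 0 -> (size w)%:Z = 1 + 1.
  by move/serM_neq0=> [u [v [-> /var_neq0 -> /var_neq0 ->]]].
move=> [v|a] w /=; first exact: h.
rewrite serD; have [->|/h ->//] := eqVneq ((var k (inr a) * var k (inl (tgt a))) w) 0.
by rewrite addr0 => /h.
Qed.

Lemma twist_var s (b : B) : twist s (var k b) = s *: var k b.
Proof.
apply: funext => w; rewrite serZ /twist; have [->|/var_neq0 ->] := eqVneq (var k b w) 0.
  by rewrite !mulr0.
by rewrite expr1.
Qed.

(** Associativity of [A]. *)
Lemma mu_mu : lie_br 1 1 mu mu = fun=> 0.
Proof.
apply: funext => b; rewrite /lie_br mulr1.
have -> : sgn k 1 = -1 by [].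
suff -> : D (-1) mu (mu b) = 0 by rewrite scaler0 subr0.
case: b => [v|a]; rewrite /= ?derD !derM !der_var !twist_var !scaleN1r /=.
  by rewrite !mulNr mulrA subrr.
by rewrite !mulrDl !mulrDr !mulNr !mulrA addrK addrA subrr sub0r addNr.
Qed.

Lemma var_mul (b : B) P w :
  (var k b * P) w = if w is x :: w' then (x == b)%:R * P w' else 0.
Proof.
case: w => [|x w]; first by rewrite serM_nil mul0r.
by rewrite serM_cons mul0r add0r lquot_var serZl mul1r serZ.
Qed.

(** [D_mu] inserts a vertex before or after each arrow.  Between two consecutive
    arrows the two insertions are of the same vertex, the paths being
    composable, with opposite signs.  The insertion before the first arrow and
    the one after the last remain. *)
Lemma der_mu v v' P : path_supp v v' P ->
  D (-1) mu P = var k (inl v) * P - twist (-1) P * var k (inl v').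
Proof.
have lquot_vert u v1 P1 : path_supp v1 v' P1 -> lquot (inl u) P1 = 0.
  move=> hP; apply: funext => w; apply/eqP.
  by apply: contraT => /hP[[|a s] []].
have lquot_arrow a v1 P1 : path_supp v1 v' P1 -> path_supp (tgt a) v' (lquot (inr a) P1).
  move=> hP w /hP[[|c s] [] // [<- ->] /andP[_ ? ?]]; by exists s.
have dhead_mu v1 P1 x w : path_supp v1 v' P1 -> dhead mu P1 (x :: w) =
    if w is y :: w' then match x, y with
      | inl u, inr a => (u == src a)%:R * P1 (y :: w')
      | inr a, inl u => (u == tgt a)%:R * P1 (x :: w')
      | _, _ => 0 end else 0.
  move=> hP; rewrite /dhead ser_sum big_sumType /= big1 ?add0r => [|u _]; last first.
    by rewrite (lquot_vert _ _ _ hP) mulr0.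
  under eq_bigr => a _ do rewrite mulrDl -!mulrA serD !var_mul.
  case: x w => [u|c] [|[u'|d] w] /=.
  - by rewrite big1 // => a _; rewrite !mulr0 addr0.
  - by rewrite big1 // => a _; rewrite !mul0r mulr0 addr0.
  - rewrite (bigD1 d) //= big1 ?addr0 => [|a ne].
      by rewrite eqxx mul1r !mul0r addr0.
    have -> : (inr d == inr a :> B) = (a == d) by rewrite eq_sym.
    by rewrite (negbTE ne) !mul0r mulr0 addr0.
  - by rewrite big1 // => a _; rewrite !mulr0 addr0.
  - rewrite (bigD1 c) //= big1 ?addr0 => [|a ne].
      by rewrite eqxx mul1r !mul0r add0r.
    have -> : (inr c == inr a :> B) = (a == c) by rewrite eq_sym.
    by rewrite (negbTE ne) !mul0r addr0.
  - by rewrite big1 // => a _; rewrite !mul0r mulr0 addr0.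
move=> hP; apply: funext => w; elim: w v P hP => [|x w IH] v P hP.
  rewrite serD serN !serM_nil der_nil /dhead ser_sum big1 => [|a _].
    by rewrite mul0r mulr0 subrr.
  rewrite serM_nil; have -> : mu a [::] = 0; last by rewrite mul0r.
  by case: a => a; rewrite /mu ?serD !serM_nil !mul0r ?addr0.
have P0 u z : P (inl u :: z) = 0 by have := congr1 (fun K : series => K z) (lquot_vert u _ _ hP).
rewrite serD serN var_mul [der _ _ _ _]/= (dhead_mu _ _ _ _ hP) serM_cons lquot_twist serZl.
case: x => [u|a].
  rewrite (lquot_vert u _ _ hP) der0.
  have -> : twist (-1) 0 = 0 :> series by apply: funext => z; rewrite /twist ser0 mulr0.
  rewrite mul0r scaler0 !ser0 mulr0 !addr0 /twist /= mul1r.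
  case: w {IH} => [|[u'|a] w] /=.
  - have [->|/hP[[|? ?] [e1 _ e2] //]] := eqVneq (P [::]) 0.
      by rewrite mulr0 mul0r subrr.
    by rewrite /var eqseq_cons eqxx andbT -e2 mulrC subrr.
  - by rewrite P0 /var eqseq_cons andbF !mulr0 subrr.
  - rewrite /var eqseq_cons andbF mulr0 subr0.
    have [->|/hP[[|c s] [] // [<- _] /andP[/eqP <- _] _]] := eqVneq (P (inr a :: w)) 0.
      by rewrite !mulr0.
    by congr (_ * _).
rewrite (IH _ _ (lquot_arrow _ _ _ hP)) !serD !serN !var_mul !serZ.
have -> : var k (inl v') (inr a :: w) = 0 by [].
move: ((twist _ _ * _) w) => /= X.
case: w {IH} => [|[u|c] w]; rewrite ?mul0r; first ring; last ring.
have -> : (inl u == inl (tgt a) :> B) = (u == tgt a) by [].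
rewrite /lquot; ring.
Qed.

(** The differential of a cochain of arity [n] takes values in [rad A] and
    depends only on the components of the cochain along the vertices, because
    the product of two arrows is zero. *)
Definition series_delta F (n : nat) : B -> series := fun b => match b with
  | inl _ => 0
  | inr a => F (inl (src a)) * var k b
             + (-1) ^+ n.+1 *: (var k b * F (inl (tgt a)))
  end.
Lemma sgn_pred m : sgn k (m%:Z - 1) = (-1) ^+ m.+1.
Proof. by rewrite sgnD {2}/sgn exprN1 invrN1 /sgn exprSr. Qed.

(** The ends left over by [D_mu] cancel against the terms of [D_F mu] in which
    [F] replaces an arrow and, for the components along the vertices, all terms
    cancel. *)
Lemma lie_br_mu (n : nat) F : path_family F -> homog (n%:Z - 1) F ->
  lie_br 1 (n%:Z - 1) mu F = series_delta F n.
Proof.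
move=> hF hi; apply: funext => b; rewrite /lie_br mul1r.
have -> : sgn k 1 = -1 by [].
rewrite sgn_pred.
have -> : D (-1) mu (F b) = var k (inl (bsrc b)) * F b + (-1)^+n.+1 *: (F b * var k (inl (btgt b))).
  rewrite (der_mu (hF b)).
  have -> : twist (-1) (F b) = (-1)^+n *: F b.
    apply: funext => w; rewrite serZ /twist; have [->|/hi] := eqVneq (F b w) 0.
      by rewrite !mulr0.
    by move=> e; congr (_ ^+ _ * _); apply/eqP; rewrite -eqz_nat e subrK.
  by rewrite serZl exprS mulN1r scaleNr.
have ss : (-1) ^+ n.+1 * (-1) ^+ n.+1 = 1 :> k by rewrite -exprD addnn -signr_odd odd_double.
case: b => [v|a]; rewrite /= ?derD !derM !der_var !twist_var.
  by rewrite scalerDr scalerA ss scale1r serZl; apply: funext => w; rewrite !serE; ring.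
rewrite scalerDr scalerA ss scale1r !serZl.
by apply: funext => w; rewrite !serE; ring.
Qed.

Lemma path_family_delta F n : path_family F -> path_family (series_delta F n).
Proof.
have hv (b : B) : is_arrow b -> path_supp (bsrc b) (btgt b) (var k b).
  by case: b => // a _ w /var_neq0 ->; exists [:: a]; rewrite /= eqxx.
move=> hF [v|a] /=; first by move=> w; rewrite eqxx.
rewrite addrC; apply: path_supp_lin.
  by apply: path_suppM (hF (inl (tgt a))); exact: (hv (inr a)).
by apply: (path_suppM (hF (inl (src a)))); exact: (hv (inr a)).
Qed.

(** The sum over paths becomes a sum over all words of arrows: words that are not
    paths do not contribute, and among the empty words only the one at the
    source of [b] does. *)
Lemma ceval_series_of n f a b : ebimod f ->
  ceval n f a b = \sum_(s : n.-tuple (arrow Q))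
    (\prod_(j < n) a j (inr (tnth s j))) * series_of f b (letters s).
Proof.
move=> /ebimodP hf.
have E (s : n.-tuple (arrow Q)) :
    \sum_(q : AP Q n | (val q).2 == s) f (qp q) b = series_of f b (letters s).
  case: (boolP (chain (bsrc b) s)) => hc.
    pose q0 : AP Q n := exist (fun p : vert Q * n.-tuple (arrow Q) => chain p.1 p.2)
                          (bsrc b, s) hc.
    rewrite (bigD1 q0) //= big1 ?addr0 => [|q /andP[/eqP e ne]].
      by rewrite -(series_of_path f (p := qp q0)).
    apply/eqP; apply: contraR ne => /hf[e1 _]; apply/eqP/val_inj.
    by rewrite /= e1 -e /start /=; case: (sval q).
  rewrite big1 => [|q /eqP e].
    apply/esym/eqP; apply: contraR hc => /series_of_neq0[p [<- /(congr1 arrows)]].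
    by rewrite !arrowsK => -> _; exact: (valP p).
  apply/eqP; apply: contraR hc => /hf[-> _].
  by rewrite -e; exact: (valP q).
rewrite /ceval sum_ffunE (partition_big (fun q : AP Q n => (val q).2) xpredT) //=.
apply: eq_bigr => s _; rewrite -E mulr_sumr; apply: eq_bigr => q /eqP <-.
by rewrite !ffunE.
Qed.

Lemma ceval_ext n f a a' : (forall j : nat, (j < n)%N -> a j = a' j) -> ceval n f a = ceval n f a'.
Proof.
move=> e; apply: eq_bigr => q _; congr (_ *: _); rewrite !ffunE.
by apply: eq_bigr => j _; rewrite e.
Qed.

Lemma ceval_subst f b (u1 u2 : seq (arrow Q)) (x : A) : ebimod f ->
  ceval (size u1 + (size u2).+1) f
    (nth 0 (map (@arr k Q) u1 ++ x :: map (@arr k Q) u2)) b =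
  \sum_(c : arrow Q) x (inr c) * series_of f b (letters (u1 ++ c :: u2)).
Proof.
move=> hf; rewrite ceval_series_of //.
set l := _ ++ _; set n := (_ + _)%N.
have hi : (size u1 < n)%N by rewrite /n addnS ltnS leq_addr.
pose i0 := Ordinal hi.
rewrite (partition_big (fun s : n.-tuple (arrow Q) => tnth s i0) xpredT) //=.
apply: eq_bigr => c _.
have hs : size (u1 ++ c :: u2) == n by rewrite size_cat.
have lE (j : 'I_n) a : j != i0 -> nth 0 l j (inr a) = (a == nth c (u1 ++ c :: u2) j)%:R.
  rewrite -val_eqE /= => ne.
  have -> : nth 0 l j = nth 0 (map (@arr k Q) (u1 ++ c :: u2)) j.
    rewrite /l map_cat !nth_cat size_map; case: ltnP => //.
    by rewrite leq_eqVlt eq_sym (negbTE ne) /= -subn_gt0; case: (_ - _)%N.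
  by rewrite (nth_map c) ?(eqP hs) // ffunE.
have l0 : nth 0 l i0 = x by rewrite /l nth_cat size_map /= ltnn subnn.
rewrite (bigD1 (Tuple hs)) /=; last first.
  by rewrite (tnth_nth c) /= nth_cat ltnn subnn.
rewrite [X in _ + X]big1 ?addr0 => [|s /andP[/eqP e ne]].
  rewrite (bigD1 i0) //= l0 (tnth_nth c) /= nth_cat ltnn subnn big1 ?mulr1 //=.
  by move=> j /lE ->; rewrite (tnth_nth c) eqxx.
have [j nj] : exists j, tnth s j != nth c (u1 ++ c :: u2) j.
  apply/existsP; rewrite -negb_forall; apply: contra ne => /forallP h.
  by apply/eqP/eq_from_tnth => j; rewrite (eqP (h j)) (tnth_nth c).
have nj0 : j != i0.
  by apply: contraNneq nj => ->; rewrite e nth_cat /= ltnn subnn.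
by rewrite (bigD1 j) //= lE // (negbTE nj) !mul0r.
Qed.

Lemma ceval_arr f n (s : seq (arrow Q)) b : ebimod f -> size s = n ->
  ceval n f (nth 0 (map (@arr k Q) s)) b = series_of f b (letters s).
Proof.
move=> hf <-; case: s => [|a s].
  rewrite ceval_series_of //= (bigD1 [tuple]) //= big_ord0 mul1r big1 ?addr0 //.
  by move=> t; rewrite tuple0.
have := ceval_subst b [::] s (arr k a) hf; rewrite /= => ->.
rewrite (bigD1 a) //= ffunE eqxx mul1r big1 ?addr0 // => c ne.
by rewrite ffunE [inr c == _](negbTE ne) mul0r.
Qed.

Lemma serM_homog m P K w : (forall u, P u != 0 -> size u = m) -> (m <= size w)%N ->
  (P * K) w = P (take m w) * K (drop m w).
Proof.
move=> hP hm; rewrite [(P * K) w]/(smul P K w) /smul.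
rewrite (bigD1 (Ordinal (hm : (m < (size w).+1)%N))) //= big1 ?addr0 // => j ne.
have [->|/hP] := eqVneq (P (take j w)) 0; first by rewrite mul0r.
rewrite size_takel; last by rewrite -ltnS.
by move=> e; rewrite -val_eqE /= e eqxx in ne.
Qed.

Lemma der_homog s F n m P w : (forall b u, F b u != 0 -> size u = m) ->
  (forall u, P u != 0 -> size u = n) -> (size w).+1 = (n + m)%N ->
  der s F P w = \sum_(i < n) s ^+ i * \sum_b
     F b (take m (drop i w)) * P (take i w ++ b :: drop (i + m) w).
Proof.
move=> hF; elim: n P w => [|n IH] P w hP hw.
  rewrite big_ord0; apply/eqP.
  by apply: contraT => /der_neq0[b [u [v [u' [_ _ /hP]]]]]; rewrite size_cat addnS.
rewrite big_ord_recl expr0 mul1r drop0 take0.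
have hl b u : lquot b P u != 0 -> size u = n by move/hP => [].
have -> : der s F P w = dhead F P w + if w is x :: w' then s * der s F (lquot x P) w' else 0.
  by case: w {hw}.
congr (_ + _).
  rewrite /dhead ser_sum; apply: eq_bigr => b _.
  by rewrite (serM_homog _ (hF b)) //; move: hw; lia.
case: w hw => [|x w] /= hw.
  have n0 : n = 0%N by move: hw; lia.
  by rewrite n0 big_ord0.
rewrite (IH _ _ (hl x)); last by case: hw.
rewrite mulr_sumr; apply: eq_bigr => j _; rewrite exprS mulrA; congr (_ * _).
Qed.

(** In the summands of [f o g] the inner argument starts where the path [p] says,
    in the series it starts where the inserted letter [c] says.  They agree as
    soon as the outer word is a path from the start of [p], and otherwise both
    summands vanish. *)
Lemma circ_summand f g p (j m : nat) b c : ebimod g ->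
  g (subp p j m) (inr c) * series_of f b (letters (take j (word p) ++ c :: drop (j + m) (word p))) =
  if bsrc b == start p then
    series_of g (inr c) (letters (take m (drop j (word p)))) *
    series_of f b (letters (take j (word p) ++ c :: drop (j + m) (word p)))
  else 0.
Proof.
move=> /ebimodP hg; set E := series_of f b _.
have [->|] := eqVneq E 0; first by rewrite !mulr0; case: ifP.
case/series_of_neq0 => p' [hs /(congr1 arrows)]; rewrite !arrowsK => hw _.
have := valP p'; rewrite /= -/(start p') -/(word p') hs -hw chain_cat.
move=> /= /and3P[c1 /eqP c2 _].
case: eqP => [e|ne].
  have e2 : bsrc (inr c : B) = start (subp p j m) by rewrite /= c2 e.
  by rewrite -(series_of_path g e2).
have [->|/hg[e _]] := eqVneq (g (subp p j m) (inr c)) 0; first by rewrite mul0r.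
case: ne; apply: chain_start c1 _ _; first exact: (chain_take _ (valP p)).
by rewrite -c2 [src c]e.
Qed.

Lemma circ_series_of n m f g p b : cdeg (n%:Z - 1) f -> cdeg (m%:Z - 1) g ->
  circ n m f g p b =
  if bsrc b == start p then
    der (sgn k (m%:Z - 1)) (series_of g) (series_of f b) (letters (word p))
  else 0.
Proof.
move=> df dg; have [[hf _] [hg _]] := (df, dg).
rewrite /circ; case: eqP => [hw|nw]; last first.
  rewrite ffunE; case: ifP => // _; apply/esym/eqP; apply: contra_notT nw.
  move/(homog_der (series_of_homog df) (series_of_homog dg)); rewrite size_map /len; lia.
rewrite (@der_homog _ _ n m) ?size_map //; first last.
- by move=> u /(series_of_homog df); lia.
- by move=> c u /(series_of_homog dg); lia.
rewrite sum_ffunE.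
rewrite (_ : (if _ then _ else _) = \sum_(j < n) if bsrc b == start p then
   sgn k (m%:Z - 1) ^+ j * \sum_c series_of g c (take m (drop j (letters (word p)))) *
     series_of f b (take j (letters (word p)) ++ c :: drop (j + m) (letters (word p)))
     else 0); last first.
  by case: ifP => // _; rewrite big1.
apply: eq_bigr => j _; rewrite ffunE sgn_pred -exprM mulnC.
have hj : (j + m <= size (word p))%N by move: hw (ltn_ord j); rewrite /len; lia.
have e1 : size (take j (word p)) = j by rewrite size_takel //; move: hj; lia.
have e2 : size (drop (j + m) (word p)) = (n - j.+1)%N.
  by rewrite size_drop; move: hw; rewrite /len; lia.
have en : n = (size (take j (word p)) + (size (drop (j + m) (word p))).+1)%N.
  by rewrite e1 e2; move: (ltn_ord j); lia.
rewrite (@ceval_ext n f _ (nth 0 (map (@arr k Q) (take j (word p)) ++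
   g (subp p j m) :: map (@arr k Q) (drop (j + m) (word p))))); last first.
  move=> l ln; rewrite nth_cat size_map e1; case: ltnP => lj.
    by rewrite map_take nth_take.
  case: eqP => [->|ne]; first by rewrite subnn.
  have -> : (l - j = (l - j).-1.+1)%N by move: lj ne; lia.
  by rewrite /= map_drop nth_drop; congr nth; move: lj ne; lia.
rewrite [X in ceval X]en ceval_subst //.
rewrite big_sumType /= [X in _ * (X + _)]big1 ?add0r => [|v _]; last first.
  rewrite [X in _ * X](_ : _ = 0) ?mulr0 //; apply/eqP.
  apply: contraT => /series_of_neq0[p' [_ /esym/letters_split[s1 [[|? ?] [_ _ //]]]]].
under eq_bigr => c _ do rewrite circ_summand //.
case: ifP => _; last by rewrite big1 // scaler0.
congr (_ * _); apply: eq_bigr => c _.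
by rewrite /letters map_cat /= !map_take !map_drop.
Qed.
End Cochains.

(** * Evaluation of cochains on the two resolutions *)

Section Hats.
Variables (k : fieldType) (Q : quiver).
Local Notation A := (rsz k Q).
Local Notation B := (basis Q).
Local Notation cochain := (cochain k Q).
Local Notation bas := (@bas k Q).
Implicit Types (f g h : cochain) (p : qpath Q) (x y : A) (c : k) (a : nat -> A).

Lemma rszE :
  (forall c x b, (c *: x) b = c * x b :> k) *
  (forall x y b, (x + y) b = x b + y b :> k) *
  (forall x y v, (x * y) (inl v) = x (inl v) * y (inl v) :> k) *
  (forall x y d, (x * y) (inr d) =
     x (inl (src d)) * y (inr d) + x (inr d) * y (inl (tgt d)) :> k) *
  (forall b b', bas b b' = (b' == b)%:R :> k).
Proof. by do !split=> *; rewrite ffunE. Qed.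

Lemma rszZl c x y : (c *: x) * y = c *: (x * y).
Proof. by apply/ffunP => -[v|d]; rewrite !rszE ?mulrA // mulrDr !mulrA. Qed.

Lemma rszZr c x y : x * (c *: y) = c *: (x * y).
Proof.
apply/ffunP => -[v|d]; rewrite !rszE; first exact: mulrCA.
by rewrite mulrDr; congr (_ + _); exact: mulrCA.
Qed.

Lemma rsz_basis x : x = \sum_b x b *: bas b.
Proof.
apply/ffunP => b; rewrite sum_ffunE (bigD1 b) //= big1 ?addr0 => [|b' ne].
  by rewrite rszE [bas b b]rszE eqxx mulr1.
by rewrite rszE [bas b' b]rszE eq_sym (negbTE ne) mulr0.
Qed.

Lemma bas_idem b : bas b * idem k (btgt b) = bas b.
Proof.
apply/ffunP => b'; rewrite mul_idem !ffunE.
by case: (b' =P b) => [->|]; rewrite ?eqxx ?mulr1 ?mul0r.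
Qed.
Lemma idem_bas b : idem k (bsrc b) * bas b = bas b.
Proof.
apply/ffunP => b'; rewrite idem_mul !ffunE.
by case: (b' =P b) => [->|]; rewrite ?eqxx ?mulr1 ?mulr0.
Qed.

Lemma idem_idem v w : idem k v * idem k w = (v == w)%:R *: idem k v :> A.
Proof.
apply/ffunP => b'; rewrite mul_idem !ffunE.
case: (b' =P inl v) => [->|_] /=; last by rewrite mul0r; exact/esym/mulr0.
by rewrite mul1r; exact/esym/mulr1.
Qed.

(** Only tensors of composable factors contribute, so sums over the basis of a
    tensor product over [E] can be extended to all triples. *)
Lemma bas_hom0 f p b b' : ebimod f ->
  ~~ ((btgt b == start p) && (finish p == bsrc b')) -> bas b * f p * bas b' = 0.
Proof.
move=> -> ; rewrite -(bas_idem b) -(idem_bas b') !mulrA.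
rewrite -[_ * idem k (start p)]mulrA idem_idem -[_ * idem k (bsrc b')]mulrA idem_idem.
rewrite !(rszZl, rszZr).
by case: (btgt b == _); case: (finish p == _); rewrite // ?scale0r ?scaler0.
Qed.

(** The linear map [k AP_n -> A] that corresponds to [f]. *)
Definition kAP_eval n f (w : kAP k Q n) : A := \sum_q w q *: f (qp q).

Lemma sum_sig (T : finType) (P : pred T) (V : nmodType) (F : T -> V) :
  (forall t, ~~ P t -> F t = 0) -> \sum_t F t = \sum_(u : {t | P t}) F (val u).
Proof.
move=> h; rewrite (bigID P) /= [X in _ + X]big1 // addr0.
rewrite (reindex_omap (val : {t | P t} -> T) insub) => [|t Pt]; last first.
  by rewrite insubT.
by apply: eq_bigl => -[t Pt] /=; rewrite insubT Pt /= eqxx.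
Qed.

Lemma bdz_hat_btens n f x (w : kAP k Q n) y : ebimod f ->
  bdz_hat f (btens x w y) = x * kAP_eval f w * y.
Proof.
move=> hf; rewrite /bdz_hat.
pose G (t : B * AP Q n * B) :=
  (x t.1.1 * w t.1.2 * y t.2) *: (bas t.1.1 * f (qp t.1.2) * bas t.2).
rewrite (eq_bigr (fun t => G (val t))); last first.
  by move=> -[[[b p] b'] hp] _; rewrite ffunE.
rewrite -sum_sig => [|t /(bas_hom0 hf) e]; last by rewrite /G e scaler0.
rewrite -(pair_bigA _ (fun t b' => G (t, b'))) -(pair_bigA _ (fun b q => \sum_b' G (b, q, b'))) /=.
rewrite [in RHS](rsz_basis x) !mulr_suml; apply: eq_bigr => b _.
rewrite /kAP_eval mulr_sumr mulr_suml; apply: eq_bigr => q _.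
rewrite [in RHS](rsz_basis y) mulr_sumr; apply: eq_bigr => b' _.
by rewrite /G /= !(rszZl, rszZr) !scalerA; congr (_ *: _); ring.
Qed.

Lemma kAP_eval_kpath n f p : len p = n -> kAP_eval f (kpath k n p) = f p.
Proof.
case: p => -[v s] hs; rewrite /len /word /= => sz.
have sz' : size s == n by rewrite sz.
pose q0 : AP Q n := exist (fun p : vert Q * n.-tuple (arrow Q) => chain p.1 p.2)
                          (v, Tuple sz') hs.
have e0 : qp q0 = exist (fun p : vert Q * seq (arrow Q) => chain p.1 p.2) (v, s) hs.
  exact: qpath_eq.
rewrite /kAP_eval (bigD1 q0) //= big1 ?addr0 => [|q ne].
  by rewrite ffunE -e0 eqxx scale1r.
rewrite ffunE -e0; case: eqP => [e|_]; last by rewrite scale0r.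
case/eqP: ne; apply/val_inj => /=; move/(congr1 val): e => /=.
by case: (sval q) => u t /= [-> /= e]; congr pair; apply/val_inj.
Qed.

Lemma path_letters (b : B) s b' :
  path (fun u v => btgt u == bsrc v) b (rcons (letters s) b') =
  chain (btgt b) s && (chain_end (btgt b) s == bsrc b') :> bool.
Proof.
elim: s b => [|d s IH] b; first by rewrite /= andbT.
by rewrite /= IH eq_sym andbA.
Qed.

Section BarIndex.
Variable n : nat.
Implicit Types t : bdz_idx Q n.

Definition bar_seq t : seq B :=
  (val t).1.1 :: rcons (letters (word (qp (val t).1.2))) (val t).2.

Lemma bar_seq_size t : size (bar_seq t) == n.+2.
Proof. by rewrite /= size_rcons size_map size_tuple. Qed.

Lemma nth_bar_seq t d (j : nat) : (j < n)%N ->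
  nth d (bar_seq t) j.+1 = nth d (letters (word (qp (val t).1.2))) j.
Proof. by move=> jn; rewrite /= nth_rcons size_map size_tuple jn. Qed.

Lemma bar_seq_ok t :
  sorted (fun u v => btgt u == bsrc v) (Tuple (bar_seq_size t)) &&
  [forall i : 'I_n.+2, (0 < i < n.+1)%N ==> is_arrow (tnth (Tuple (bar_seq_size t)) i)].
Proof.
apply/andP; split.
  rewrite [tval _]/= [sorted _ _]/= path_letters.
  case/andP: (valP t) => /eqP -> /eqP <-.
  by rewrite eqxx andbT; exact: (valP (qp _)).
apply/forallP => -[[|j] hj] //; apply/implyP => /= jn.
rewrite (tnth_nth (val t).2) nth_bar_seq //.
apply: (allP (all_letters (word (qp (val t).1.2)))); apply: mem_nth.
by rewrite size_map size_tuple.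
Qed.

(** This identifies the bases of the two bimodules, the arrows of a path
    becoming the inner tensor factors. *)
Definition bar_of t : bar_idx Q n := Sub (Tuple (bar_seq_size t)) (bar_seq_ok t).

Lemma bar_of_inj : injective bar_of.
Proof.
move=> t u /(congr1 (fun b => tval (val b))) /= [e1 e2].
apply/val_inj; move: e1 e2.
case: t u => -[[b q] b'] ht [[[c r] c'] hu] /= e1 /rcons_inj [/(congr1 (@arrows Q)) e ->].
subst c; move: e; rewrite !arrowsK => e; congr (_, _, _); apply/val_inj.
case/andP: ht => /eqP /= eq _; case/andP: hu => /eqP /= er _.
have e1 : (val q).1 = (val r).1 by rewrite [LHS](esym eq) er.
have e2 : (val q).2 = (val r).2 by apply/val_inj.
by rewrite [sval q]surjective_pairing [sval r]surjective_pairing e1 e2.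
Qed.

Lemma bar_of_surj b : exists t, bar_of t = b.
Proof.
case: b => -[w hw] hb; move: hw hb.
case: w => [|b w] //; case/lastP: w => [|w b'] // hw hb.
have sw : size w = n by have := hw; rewrite /= size_rcons => /eqP [].
(* The factor [w_j] has index [j + 1] in the tensor. *)
have ew : letters (arrows w) = w.
  apply: lettersK; apply/(all_nthP b) => j jw; case/andP: hb => _ /forallP.
  have hj : (j.+1 < n.+2)%N by rewrite ltnS ltnW // -sw.
  have jn : (j < n)%N by rewrite -sw.
  by move/(_ (Ordinal hj)); rewrite /= ltnS jn (tnth_nth b) /= nth_rcons jw.
have := hb; case/andP; rewrite /= -{1}ew path_letters => /andP[hc he] _.
have sa : size (arrows w) == n by rewrite -sw -{2}ew size_map.
pose q : AP Q n := exist (fun p : vert Q * n.-tuple (arrow Q) => chain p.1 p.2)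
                     (btgt b, Tuple sa) hc.
have ht : (btgt (b, q, b').1.1 == start (qp (b, q, b').1.2)) &&
  (finish (qp (b, q, b').1.2) == bsrc (b, q, b').2) by rewrite /= eqxx.
exists (Sub (b, q, b') ht); apply/val_inj/val_inj => /=.
by congr (b :: rcons _ b'); exact: ew.
Qed.

Lemma bar_of_bij : bijective bar_of.
Proof.
have hs b : b \in codom bar_of by have [t <-] := bar_of_surj b; exact: codom_f.
exists (fun b => iinv (hs b)) => [t|b]; last exact: f_iinv.
by apply: bar_of_inj; rewrite f_iinv.
Qed.

Lemma bfac_bar_of t :
  [/\ bfac k (bar_of t) 0 = bas (val t).1.1,
     forall j : nat, (j < n)%N -> bfac k (bar_of t) j.+1 = parr k (qp (val t).1.2) j &
     bfac k (bar_of t) n.+1 = bas (val t).2].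
Proof.
split=> [//|j jn|]; rewrite /bfac /=.
  rewrite map_rcons nth_rcons !size_map size_tuple jn /parr /letters -map_comp.
  by congr nth; apply: eq_map.
by rewrite map_rcons nth_rcons !size_map size_tuple ltnn eqxx.
Qed.

Lemma tens_bar_of a t : tens n a (bar_of t) =
  btens (a 0%N) (concat n (fun j => a j.+1)) (a n.+1) t.
Proof.
rewrite !ffunE big_ord_recl big_ord_recr /= mulrA; congr (_ * _ * _).
- apply: eq_bigr => j _; congr (a _ _); rewrite (tnth_nth (val t).2).
  have [d _] : exists d : arrow Q, true by exists (tnth (val (val t).1.2).2 j).
  rewrite [nth _ _ _](nth_bar_seq t (val t).2 (ltn_ord j)).
  by rewrite (nth_map d) ?size_tuple // (tnth_nth d).
- congr (a _ _); rewrite (tnth_nth (val t).2) /= nth_rcons size_map size_tuple.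
  by rewrite /bump /= ltnn eqxx.
Qed.
End BarIndex.

(** For the empty path the sum in [ceval] runs over all vertices, and the
    idempotent selects one. *)
Lemma ceval_parr n f p : ebimod f -> len p = n ->
  idem k (start p) * ceval n f (parr k p) = f p.
Proof.
move=> hf hp; apply/ffunP => b; rewrite idem_mul ceval_arr //.
case: eqP => [/(series_of_path f) ->|ne]; first by rewrite mul1r.
rewrite mul0r; apply/esym/eqP; apply: contra_notT ne.
by case/((ebimodP f).1 hf).
Qed.

Lemma bar_hat_bdz n f (x : bar k Q n) : ebimod f ->
  bar_hat f x = bdz_hat f [ffun t => x (bar_of t)].
Proof.
move=> hf; rewrite /bar_hat (reindex _ (onW_bij _ (bar_of_bij n))).
apply: eq_bigr => t _; rewrite ffunE; congr (_ *: _).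
case: (bfac_bar_of t) => -> hj ->.
rewrite (ceval_ext f hj).
case/andP: (valP t); case: (val t) => -[b q] b' /= /eqP e _.
rewrite -(bas_idem b) -[bas b * _ * _]mulrA e ceval_parr //.
  by rewrite -e bas_idem.
exact: size_tuple.
Qed.

(** Defined on basis tensors only, the extension of [f] is multilinear in the
    tensor factors: the identification of the bases turns the tensor into
    [a_0 (x) a_1 ... a_n (x) a_(n+1)]. *)
Lemma bar_hat_tens n f a : ebimod f ->
  bar_hat f (tens n a) = a 0%N * ceval n f (fun j => a j.+1) * a n.+1.
Proof.
move=> hf; rewrite bar_hat_bdz // -bdz_hat_btens //; congr bdz_hat.
by apply/ffunP => t; rewrite ffunE tens_bar_of.
Qed.
End Hats.

(** * Comparison morphisms, differentials and homotopy *)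

Section Comparison.
Variables (k : fieldType) (Q : quiver).
Local Notation A := (rsz k Q).
Local Notation B := (basis Q).
Local Notation cochain := (cochain k Q).
Local Notation bas := (@bas k Q).
Implicit Types (f g h : cochain) (p : qpath Q) (x y : A) (c : k) (a : nat -> A).

Lemma lin_form_sum (I J : finType) (V : lmodType k) (v : J -> V) (F : I -> k)
    (X : I -> {ffun J -> k^o}) :
  \sum_j (\sum_i F i *: X i) j *: v j = \sum_i F i *: (\sum_j X i j *: v j).
Proof.
under eq_bigr => j _ do rewrite sum_ffunE scaler_suml.
rewrite exchange_big; apply: eq_bigr => i _; rewrite scaler_sumr.
by apply: eq_bigr => j _; rewrite ffunE scalerA.
Qed.

Lemma bdz_hat_sum f n (I : finType) (F : I -> k) (X : I -> bdz k Q n) :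
  bdz_hat f (\sum_i F i *: X i) = \sum_i F i *: bdz_hat f (X i).
Proof. exact: lin_form_sum. Qed.

Lemma bar_hat_sum f n (I : finType) (F : I -> k) (X : I -> bar k Q n) :
  bar_hat f (\sum_i F i *: X i) = \sum_i F i *: bar_hat f (X i).
Proof. exact: lin_form_sum. Qed.

Lemma bdz_hatD f n c (X Y : bdz k Q n) : bdz_hat f (X + c *: Y) = bdz_hat f X + c *: bdz_hat f Y.
Proof.
rewrite /bdz_hat scaler_sumr -big_split; apply: eq_bigr => t _ /=.
by rewrite !ffunE scalerDl scalerA.
Qed.

Lemma bdz_hat_cmpG f n (X : bar k Q n) : ebimod f -> bdz_hat f (cmpG X) = bar_hat f X.
Proof.
move=> hf; rewrite bdz_hat_sum; apply: eq_bigr => b _.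
by rewrite bdz_hat_btens.
Qed.

Lemma bar_hat_cmpF f n (X : bdz k Q n) : ebimod f -> bar_hat f (cmpF X) = bdz_hat f X.
Proof.
move=> hf; rewrite bar_hat_sum; apply: eq_bigr => t _; congr (_ *: _).
case/andP: (valP t); case: (val t) => -[b q] b' /= /eqP e _.
rewrite bar_hat_tens //= nth_rcons size_map size_tuple ltnn eqxx.
rewrite (@ceval_ext _ _ n f _ (parr k (qp q))) => [|j jn]; last first.
  by rewrite nth_rcons size_map size_tuple jn.
rewrite -(bas_idem k b) -[bas b * _ * _]mulrA e ceval_parr //.
  by rewrite -e bas_idem.
exact: size_tuple.
Qed.

Lemma bdz_hat_gen f n p : ebimod f -> len p = n -> bdz_hat f (bdz_gen k n p) = f p.
Proof. by move=> hf hp; rewrite bdz_hat_btens // kAP_eval_kpath // mul1r mulr1. Qed.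

Lemma bar_hat_gen f n p : ebimod f -> len p = n -> bar_hat f (bar_gen k n p) = f p.
Proof.
move=> hf hp; rewrite bar_hat_tens //=.
rewrite (@ceval_ext _ _ n f _ (parr k p)) => [|j jn]; last first.
  by rewrite /parr; apply: set_nth_default; rewrite size_map -/(len p) hp.
by rewrite ceval_parr // nth_default ?mulr1 // size_map -/(len p) hp.
Qed.

Lemma Gstar_id f : ebimod f -> Gstar f = f.
Proof. by move=> hf; apply: funext => p; rewrite /Gstar bdz_hat_cmpG // bar_hat_gen. Qed.

Lemma Fstar_id f : ebimod f -> Fstar f = f.
Proof. by move=> hf; apply: funext => p; rewrite /Fstar bar_hat_cmpF // bdz_hat_gen. Qed.

(** What both differentials compute, before the signs [(-1)^n]. *)
Definition rsz_delta f : cochain := fun p =>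
  if len p is n.+1 then
    parr k p 0 * f (subp p 1 n) + (-1) ^+ n.+1 *: (f (subp p 0 n) * parr k p n)
  else 0.

Lemma parr_first p n : len p = n.+1 ->
  [/\ parr k p 0 = idem k (start p) * parr k p 0 &
      parr k p 0 = parr k p 0 * idem k (start (subp p 1 n))].
Proof.
case: p => -[v [|d s]] // hs _; rewrite /parr /=.
have -> : start (exist _ (v, d :: s) hs : qpath Q) = src d by case/andP: (hs) => /eqP.
by rewrite /start /= take0 /= (idem_bas k (inr d)) (bas_idem k (inr d)).
Qed.

Lemma parr_last p n : len p = n.+1 ->
  [/\ parr k p n = parr k p n * idem k (finish p) &
      parr k p n = idem k (finish (subp p 0 n)) * parr k p n].
Proof.
have := valP p; rewrite /parr /finish /len /start /word /= /start /word /=.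
case/lastP: (sval p).2 => [|s d] // hs; rewrite size_rcons => -[sz].
rewrite map_rcons nth_rcons size_map sz ltnn eqxx ?drop0 ?take0 /=.
move: hs; rewrite -cats1 take_size_cat // chain_end_cat chain_cat /= andbT => /andP[_ /eqP <-].
by rewrite (idem_bas k (inr d)) (bas_idem k (inr d)).
Qed.

Lemma finish_subp p n : len p = n.+1 -> finish (subp p 1 n) = finish p.
Proof.
move=> hp; rewrite /finish /start /word /= -chain_end_cat [take n _]take_oversize.
  by rewrite cat_take_drop.
by rewrite size_drop -/(len p) hp subSS subn0.
Qed.

Lemma start_subp p n : start (subp p 0 n) = start p.
Proof. by rewrite /start /= take0. Qed.

Lemma ebimod_idem f p : ebimod f ->
  idem k (start p) * f p = f p /\ f p * idem k (finish p) = f p.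
Proof.
move=> /(_ p) e; split; rewrite e; first by rewrite !mulrA idem_idem eqxx scale1r.
by rewrite -!mulrA idem_idem eqxx scale1r.
Qed.

Lemma rsz_delta_ebimod f : ebimod f -> ebimod (rsz_delta f).
Proof.
move=> hf p; rewrite /rsz_delta; case hp: (len p) => [|n]; first by rewrite mulr0 mul0r.
rewrite mulrDr mulrDl rszZr rszZl; congr (_ + _ *: _).
  rewrite mulrA -(parr_first hp).1 -mulrA -(finish_subp hp).
  by rewrite (ebimod_idem (subp p 1 n) hf).2.
rewrite mulrA -[_ * _ * idem _ _]mulrA -(parr_last hp).1 -(start_subp p n).
by rewrite (ebimod_idem (subp p 0 n) hf).1.
Qed.

Lemma bdz_hat_d f n (X : bdz k Q n.+1) : ebimod f -> bdz_hat f (bdz_d X) = bdz_hat (rsz_delta f) X.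
Proof.
move=> hf; rewrite bdz_hat_sum; apply: eq_bigr => t _; congr (_ *: _).
case: (val t) => -[b q] b' /=.
have hq : len (qp q) = n.+1 by apply: size_tuple.
have l1 : len (subp (qp q) 1 n) = n by rewrite len_subp hq; lia.
have l0 : len (subp (qp q) 0 n) = n by rewrite len_subp hq; lia.
rewrite bdz_hatD !bdz_hat_btens // !kAP_eval_kpath //.
by rewrite /rsz_delta hq mulrDr mulrDl rszZr rszZl !mulrA.
Qed.

Lemma bdz_delta_rsz f : ebimod f -> bdz_delta f = rsz_delta f.
Proof.
move=> hf; apply: funext => p; rewrite /bdz_delta.
case hp: (len p) => [|n]; first by rewrite /rsz_delta hp.
by rewrite bdz_hat_d // bdz_hat_gen //; exact: rsz_delta_ebimod.
Qed.

Lemma ceval0 n f a (j : nat) : (j < n)%N -> a j = 0 -> ceval n f a = 0.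
Proof.
move=> jn aj; apply: big1 => q _; rewrite ffunE (bigD1 (Ordinal jn)) //= aj ffunE mul0r.
exact: scale0r.
Qed.

Lemma arr_arr (d e : arrow Q) : arr k d * arr k e = 0.
Proof. by apply/ffunP => -[v|u]; rewrite !ffunE /= ?mul0r // mulr0 addr0. Qed.

(** The terms of [d] that multiply two inner factors vanish, these being
    arrows. *)
Lemma bar_hat_d f n (X : bar k Q n.+1) : ebimod f -> bar_hat f (bar_d X) = bar_hat (rsz_delta f) X.
Proof.
move=> hf; have hd := rsz_delta_ebimod hf; rewrite (bar_hat_bdz _ hd) bar_hat_sum.
rewrite (reindex _ (onW_bij _ (bar_of_bij Q n.+1))).
apply: eq_bigr => t _; rewrite ffunE; congr (_ *: _).
case: (bfac_bar_of k t); case/andP: (valP t); case: (val t) => -[b q] b' /= /eqP e _.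
set bf := bfac k _ => b0 bj bn.
have hq : len (qp q) = n.+1 by apply: size_tuple.
rewrite bar_hat_sum big_ord_recl big_ord_recr /= [X in _ + (X + _)]big1 => [|j _].
  rewrite add0r expr0 scale1r !bar_hat_tens // /rsz_delta hq.
  have l1 : len (subp (qp q) 1 n) = n by rewrite len_subp hq; lia.
  have l0 : len (subp (qp q) 0 n) = n by rewrite len_subp hq; lia.
  rewrite (@ceval_ext _ _ n f _ (parr k (subp (qp q) 1 n))) => [|j jn]; last first.
    rewrite /contract /= bj ?ltnS // /parr /word /= take_oversize ?map_drop ?nth_drop //.
    by rewrite size_drop size_tuple subSS subn0.
  rewrite (@ceval_ext _ _ n f (fun j => contract _ bf j.+1)
    (parr k (subp (qp q) 0 n))) => [|j jn]; last first.
    rewrite /contract /bump /= add1n ltnS jn bj; last exact: ltnW.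
    by rewrite /parr {2}/word /= drop0 map_take nth_take.
  have -> : contract 0 bf 0 = bf 0%N * bf 1%N by [].
  have -> : contract 0 bf n.+1 = bf n.+2 by [].
  have -> : contract (bump 0 n) bf 0 = bf 0%N by [].
  have -> : contract (bump 0 n) bf n.+1 = bf n.+1 * bf n.+2.
    by rewrite /contract /bump /= add1n ltnn eqxx.
  rewrite b0 bn !bj // {1}(parr_first hq).2 -!mulrA mulrDl rszZl mulrDr rszZr.
  rewrite [idem _ _ * (_ * _)]mulrA ceval_parr //; congr (_ + _ *: _).
    by rewrite !mulrA.
  by rewrite -(ceval_parr hf l0) start_subp -e -{1}(bas_idem k b) !mulrA.
have hj := ltn_ord j.
rewrite bar_hat_tens // (ceval0 (n := n) f (j := j)) ?mulr0 ?mul0r ?scaler0 //.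
have -> : contract (bump 0 j) bf j.+1 = bf j.+1 * bf j.+2.
  by rewrite /contract /bump /= add1n ltnn eqxx.
rewrite !bj ?ltnS // 1?ltnW // /parr.
have [d _] : exists d : arrow Q, true by exists (tnth (val q).2 ord0).
by rewrite !(nth_map d) ?size_tuple ?ltnS // 1?ltnW // arr_arr.
Qed.

Lemma bar_diff_rsz_delta f p : ebimod f -> bar_diff f p = (-1) ^+ (len p).-1 *: rsz_delta f p.
Proof.
move=> hf; rewrite /bar_diff; case hp: (len p) => [|n]; first by rewrite /rsz_delta hp scaler0.
by rewrite bar_hat_d // bar_hat_gen //; exact: rsz_delta_ebimod.
Qed.

Lemma bdz_diff_bar f : ebimod f -> bdz_diff f = bar_diff f.
Proof.
by move=> hf; apply: funext => p; rewrite bar_diff_rsz_delta // /bdz_diff bdz_delta_rsz.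
Qed.

(** [s] takes the radical part of the first factor. *)
Lemma bar_s_vert n (X : bar k Q n) :
  (forall b d, tnth (val b) ord0 = inr d -> X b = 0) -> bar_s X = 0.
Proof.
move=> h; apply: big1 => b _; case e: (tnth (val b) ord0) => [v|d]; last first.
  by rewrite (h b d e) scale0r.
apply/ffunP => b'; rewrite ffunE [tens _ _ _](_ : _ = 0) ?ffunE; first exact: mulr0.
rewrite (bigD1 (lift ord0 ord0)) //= ffunE /bfac.
have -> : nth 0 [seq bas i | i <- val (val b)] 0 = bas (inl v).
  by rewrite (nth_map (inl v)) ?size_tuple // -(tnth_nth _ _ ord0) e.
by rewrite ffunE; case: (tnth _ _) => u; rewrite mul0r.
Qed.

Lemma cmpF_vert n (X : bdz k Q n) :
  (forall t d, (val t).1.1 = inr d -> X t = 0) ->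
  forall b d, tnth (val b) ord0 = inr d -> cmpF X b = 0.
Proof.
move=> h b d e; rewrite /cmpF sum_ffunE big1 // => t _.
case e1: (val t) => [[c q] c']; case: c e1 => [v|d'] e1; last first.
  by rewrite (h t d') ?e1 // scale0r ffunE.
rewrite !ffunE big_ord_recl /= ffunE e mul0r; exact: mulr0.
Qed.

Lemma cmpG_vert n (X : bar k Q n) :
  (forall b d, tnth (val b) ord0 = inr d -> X b = 0) ->
  forall t d, (val t).1.1 = inr d -> cmpG X t = 0.
Proof.
move=> h t d e; rewrite /cmpG sum_ffunE big1 // => b _.
case eb: (tnth (val b) ord0) => [v|d']; last by rewrite (h b d') // scale0r ffunE.
rewrite !ffunE /bfac.
have -> : nth 0 [seq bas i | i <- val (val b)] 0 = bas (inl v).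
  by rewrite (nth_map (inl v)) ?size_tuple // -(tnth_nth _ _ ord0) eb.
rewrite ffunE e !mul0r; exact: mulr0.
Qed.

Lemma bar_s0 n : bar_s (0 : bar k Q n) = 0.
Proof. by apply: bar_s_vert => b d _; rewrite ffunE. Qed.

(** The hypothesis of [bar_s_vert] holds for [1 (x) x] and is preserved by [G]
    and [F]; by induction the second term of [H_n] vanishes as well. *)
Lemma cmpH0 n (X : bar k Q n) : cmpH X = 0.
Proof.
elim: n X => [//|n IH] X.
have -> : cmpH X = \sum_b X b *: bar_lact (bfac k b 0)
    (let ux := tens n.+1 (fun j => if j == 0%N then 1 else bfac k b j) in
     bar_s (cmpF (cmpG ux)) - bar_s (cmpH (bar_d ux))) by [].
apply: big1 => b _ /=; rewrite IH bar_s0 subr0 bar_s_vert; first last.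
  apply/cmpF_vert/cmpG_vert => b' d e.
  by rewrite ffunE big_ord_recl /= ffunE e mul0r.
rewrite /bar_lact big1 ?scaler0 // => b' _; rewrite ffunE; exact: scale0r.
Qed.

Lemma Hstar0 f : Hstar f = 0.
Proof.
apply: funext => p; rewrite /Hstar cmpH0 /bar_hat big1 ?scaler0 // => b _.
by rewrite ffunE; exact: scale0r.
Qed.
End Comparison.

(** * The dg-Lie algebra of Hochschild cochains *)

Section DgLie.
Variables (k : fieldType) (Q : quiver).
Local Notation A := (rsz k Q).
Local Notation B := (basis Q).
Local Notation cochain := (cochain k Q).
Local Notation series := (series k B).
Local Notation bas := (@bas k Q).
Implicit Types (f g h : cochain) (p : qpath Q) (F G H : B -> series) (i j l : int).

Lemma cdeg0 i : cdeg i (0 : cochain).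
Proof. by split=> // p; rewrite mulr0 mul0r. Qed.

Lemma cdeg_lin i c f g : cdeg i f -> cdeg i g -> cdeg i (c *: f + g).
Proof.
move=> [hf df] [hg dg]; split=> p.
  rewrite [(c *: f + g) p]/(c *: f p + g p) {1}hf {1}hg mulrDr mulrDl.
  by rewrite rszZr rszZl.
move=> hp; rewrite [(c *: f + g) p]/(c *: f p + g p) (df p hp) (dg p hp) scaler0; exact: addr0.
Qed.

Lemma series_of0 : series_of (0 : cochain) = fun=> 0.
Proof.
apply: funext => b; apply: funext => w; rewrite /series_of.
by case: ifP => // _; case: insub => // p; rewrite ffunE.
Qed.

Lemma cochain_of0 : cochain_of (fun=> 0) = 0 :> cochain.
Proof. by apply: funext => p; apply/ffunP => b; rewrite !ffunE; case: ifP. Qed.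

Lemma lie_br0l i j G : lie_br i j (fun=> 0) G = fun=> 0.
Proof.
apply: funext => b; rewrite /lie_br der0 sub0r.
have := der_linl (sgn k i) (fun=> 0) (fun=> 0) (-1) (G b).
rewrite (_ : (fun a : B => -1 *: 0 + 0) = fun=> 0 :> series); last first.
  by apply: funext => a; rewrite scaler0 addr0.
by rewrite scaleN1r addNr => ->; rewrite scaler0 oppr0.
Qed.

Lemma lie_br0r i j F : lie_br i j F (fun=> 0) = fun=> 0.
Proof. by rewrite lie_br_anti lie_br0l; apply: funext => b; rewrite scaler0 oppr0. Qed.

(** In degrees below [-1] there is no arity, and the cochain is zero. *)
Lemma cdeg_unshift i f : cdeg i f -> i = (unshift i)%:Z - 1 \/ f = 0.
Proof.
case=> _ h; rewrite /unshift; case e: (i + 1) => [n|n]; first by left; rewrite -e addrK.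
by right; apply: funext => p; apply: h; rewrite e.
Qed.

Lemma gbrE (n m : nat) f g : cdeg (n%:Z - 1) f -> cdeg (m%:Z - 1) g ->
  gbr n m f g = cochain_of (lie_br (n%:Z - 1) (m%:Z - 1) (series_of f) (series_of g)).
Proof.
move=> hf hg; apply: funext => p; apply/ffunP => b.
rewrite [gbr n m f g p]/(circ n m f g p - _ *: circ m n g f p) !ffunE !circ_series_of //.
by case: ifP => _; rewrite /lie_br ?serE // scaler0 subr0.
Qed.

Lemma sbrE i j f g : cdeg i f -> cdeg j g ->
  sbr i j f g = cochain_of (lie_br i j (series_of f) (series_of g)).
Proof.
move=> hf hg; rewrite /sbr.
case: (cdeg_unshift hf) => [ei|f0]; case: (cdeg_unshift hg) => [ej|g0].
- by rewrite gbrE -?ei -?ej.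
- by rewrite g0 gbrE -?ei ?series_of0 ?lie_br0r //; exact: cdeg0.
- by rewrite f0 gbrE -?ej ?series_of0 ?lie_br0l //; exact: cdeg0.
- by rewrite f0 g0 gbrE ?series_of0 ?lie_br0l //; exact: cdeg0.
Qed.

(** The sign [- (-1)^n] of the shifted differential turns the coefficient of
    [p_0 f(p_1 ...)] into [(-1)^(n+1)] and that of [f(p_0 ...) p_n] into [1]. *)
Lemma rsz_delta_series_of (n : nat) f : cdeg (n%:Z - 1) f ->
  (fun p => - ((-1) ^+ (len p).-1 *: rsz_delta f p)) = cochain_of (series_delta (series_of f) n).
Proof.
move=> hc; have [hf hd] := hc; have hF := series_of_homog hc.
have dF : homog n%:Z (series_delta (series_of f) n).
  rewrite -(lie_br_mu (series_of_path_family hf) hF).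
  have -> : homog n%:Z = homog (k := k) (T := B) (1 + (n%:Z - 1)) by rewrite addrC subrK.
  by apply: homog_br hF; exact: mu_deg.
apply: funext => p; apply/ffunP => b; rewrite [RHS]ffunE.
have -> : (- ((-1) ^+ (len p).-1 *: rsz_delta f p)) b =
    - ((-1) ^+ (len p).-1 * rsz_delta f p b) :> k.
  by rewrite !ffunE.
have [hp|hp] := eqVneq (len p) n.+1; last first.
  have -> : rsz_delta f p = 0.
    rewrite /rsz_delta; case e: (len p) hp => [//|m] hp.
    rewrite !hd ?len_subp ?e ?mulr0 ?mul0r ?scaler0; [exact: addr0|lia|lia].
  rewrite ffunE mulr0 oppr0; case: ifP => // _.
  have [-> //|/dF] := eqVneq (series_delta (series_of f) n b (letters (word p))) 0.
  by rewrite size_map -/(len p) => e; case/eqP: hp; move: e; lia.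
have pE (d a : arrow Q) (j : nat) : (j < len p)%N ->
    parr k p j (inr a) = (a == nth d (word p) j)%:R /\ forall v, parr k p j (inl v) = 0 :> k.
  by move=> hj; rewrite /parr (nth_map d) //; split=> *; rewrite ffunE.
have [d hd0] : exists d : arrow Q, true.
  by move: hp; rewrite /len; case: (word p) => // d; exists d.
rewrite /rsz_delta hp; case: b => [v|a].
  rewrite !rszE !(pE d d _ _).2 ?hp // mul0r !mulr0 addr0 mulr0 oppr0.
  by case: ifP.
rewrite !rszE !(pE d d _ _).2 ?hp // !(pE d a _ _).1 ?hp // mul0r mulr0 add0r addr0.
have -> w : series_delta (series_of f) n (inr a) w = (series_of f (inl (src a)) * var k (inr a)) w
    + (-1) ^+ n.+1 * (var k (inr a) * series_of f (inl (tgt a))) w by [].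
rewrite var_mul (serM_homog (m := n)); first last.
- by rewrite size_map -/(len p) hp.
- by move=> u /hF; lia.
have hsz : size (word p) = n.+1 by [].
have -> : drop n (letters (word p)) = [:: inr (nth d (word p) n)].
  rewrite /letters -map_drop (drop_nth d) ?hsz // drop_oversize ?hsz //.
have -> : take n (letters (word p)) = letters (word (subp p 0 n)).
  by rewrite /word /= drop0 /letters map_take.
have -> : var k (inr a : B) [:: inr (nth d (word p) n)] = (a == nth d (word p) n)%:R.
  by rewrite /var eqseq_cons andbT eq_sym.
have -> : match letters (word p) return k with
    | [::] => 0
    | x :: w' => (x == inr a)%:R * series_of f (inl (tgt a)) w'
    end = (a == nth d (word p) 0)%:R * f (subp p 1 n) (inl (tgt a)) :> k.
  case hw: (word p) hsz => [//|d' s] [hs] /=.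
  have -> : (inr d' == inr a :> B) = (a == d') by rewrite eq_sym.
  case: (a =P d') => [->|_]; last by rewrite !mul0r.
  rewrite -(series_of_path f (p := subp p 1 n)).
    have -> // : word (subp p 1 n) = s.
    by rewrite {1}/word /= hw /= drop0 take_oversize // hs.
  by rewrite /start /= hw /= take0.
have sgn1 : (-1) ^+ n * (-1) ^+ n = 1 :> k.
  by rewrite -exprD addnn -signr_odd odd_double.
case: ifP => [/eqP e|/eqP ne].
  by rewrite (series_of_path f) ?start_subp //= exprS; ring: sgn1.
have [->|/((ebimodP f).1 hf)[e _]] := eqVneq (f (subp p 0 n) (inl (src a))) 0; last first.
  by case: ne; rewrite -(start_subp p n).
case: (a =P _) => [e|_]; last by rewrite !mul0r mulr0 addr0 mulr0 oppr0.
case: ne; rewrite /= e; have := valP p; rewrite /= -/(word p).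
by case: (word p) hsz => // d' s _ /= /andP[/eqP].
Qed.

Lemma cochain_ofDZ c F G : cochain_of (fun b => F b + c *: G b) = cochain_of F + c *: cochain_of G.
Proof.
by rewrite addrC -cochain_of_lin; congr cochain_of; apply: funext => b; rewrite addrC.
Qed.

Lemma bar_diff0 : bar_diff (0 : cochain) = 0.
Proof.
apply: funext => p; rewrite bar_diff_rsz_delta; last by case: (cdeg0 0).
rewrite /rsz_delta; case: (len p) => [|n]; rewrite ?mulr0 ?mul0r ?scaler0 //.
by rewrite (addr0 (0 : A)) scaler0.
Qed.

Lemma hoch_dE i f : cdeg i f -> - bar_diff f = cochain_of (lie_br 1 i (@mu k Q) (series_of f)).
Proof.
move=> hf; case: (cdeg_unshift hf) => [e|->]; last first.
  by rewrite bar_diff0 series_of0 lie_br0r cochain_of0 oppr0.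
rewrite e in hf *; case: (hf) => he _.
rewrite lie_br_mu; [|exact: series_of_path_family|exact: series_of_homog].
rewrite -rsz_delta_series_of //; apply: funext => p.
by rewrite -bar_diff_rsz_delta.
Qed.

Lemma path_family_mu i f : cdeg i f -> path_family (lie_br 1 i (@mu k Q) (series_of f)).
Proof.
move=> hf; case: (cdeg_unshift hf) => [e|->]; last first.
  by rewrite series_of0 lie_br0r => b w; rewrite eqxx.
rewrite e in hf *; case: (hf) => he _.
rewrite lie_br_mu; [|exact: series_of_path_family|exact: series_of_homog].
exact/path_family_delta/series_of_path_family.
Qed.

Lemma lie_br_linr i j c F G G' :
  lie_br i j F (fun b => c *: G b + G' b) = fun b => c *: lie_br i j F G b + lie_br i j F G' b.
Proof.
apply: funext => b; rewrite /lie_br der_lin der_linl.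
by apply: funext => w; rewrite !serE; ring.
Qed.

(** The Jacobi identity for [mu], [mu], [F] says that this expression equals its
    opposite. *)
Lemma lie_br_mu_mu i F : 2%:R != 0 :> k -> homog i F ->
  lie_br 1 (1 + i) (@mu k Q) (lie_br 1 i (@mu k Q) F) = fun=> 0.
Proof.
move=> h2 hF; have := lie_br_jacobi (@mu_deg k Q) (@mu_deg k Q) hF.
rewrite mu_mu lie_br0l; set X := lie_br _ _ _ _ => e.
apply: funext => b; apply: funext => w; apply/eqP.
have : X b w = 0 + sgn k (1 * 1) * X b w by rewrite {1}e.
have -> : sgn k (1 * 1) = -1 by [].
move=> /eqP; rewrite add0r mulN1r -addr_eq0 -mulr2n -mulr_natl mulf_eq0.
by rewrite (negbTE h2).
Qed.

Lemma hoch_dgLie : 2%:R != 0 :> k -> is_dgLie (hoch_dgl k Q).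
Proof.
move=> h2; have he i f : cdeg i f -> ebimod f by case.
have fs i f : cdeg i f -> path_family (series_of f) by move/he/series_of_path_family.
have brdeg i j f g : cdeg i f -> cdeg j g -> cdeg (i + j) (sbr i j f g).
  move=> hf hg; rewrite (sbrE hf hg).
  apply: cdeg_cochain_of; last by apply: homog_br; exact: series_of_homog.
  by apply: path_family_br; [exact: fs hf|exact: fs hg].
have ddeg i f : cdeg i f -> cdeg (i + 1) (- bar_diff f).
  move=> hf; rewrite (hoch_dE hf) addrC; apply: cdeg_cochain_of; first exact: path_family_mu.
  by apply: homog_br; [exact: mu_deg|exact: series_of_homog].
have series_of_br i j f g : cdeg i f -> cdeg j g ->
    series_of (sbr i j f g) = lie_br i j (series_of f) (series_of g).
  move=> hf hg; rewrite (sbrE hf hg) cochain_ofK //.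
  by apply: path_family_br; [exact: fs hf|exact: fs hg].
have series_of_d i f : cdeg i f -> series_of (- bar_diff f) = lie_br 1 i (@mu k Q) (series_of f).
  by move=> hf; rewrite (hoch_dE hf) cochain_ofK //; exact: path_family_mu.
split=> /=.
- exact: cdeg0.
- by move=> i c x y; exact: cdeg_lin.
- by move=> i x; exact: ddeg.
- move=> i c x y hx hy.
  by rewrite !(@hoch_dE i) ?series_of_lin ?lie_br_linr ?cochain_of_lin //; exact: cdeg_lin.
- by move=> i j x y; exact: brdeg.
- move=> i j c x x' y hx hx' hy.
  by rewrite !sbrE ?series_of_lin ?lie_br_linl ?cochain_of_lin //; exact: cdeg_lin.
- move=> i j c x y y' hx hy hy'.
  by rewrite !sbrE ?series_of_lin ?lie_br_linr ?cochain_of_lin //; exact: cdeg_lin.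
- move=> i x hx; rewrite (hoch_dE (ddeg _ _ hx)) (series_of_d _ _ hx) [i + 1]addrC.
  by rewrite lie_br_mu_mu ?cochain_of0 //; exact: series_of_homog.
- move=> i j x y hx hy; rewrite !sbrE // lie_br_anti.
  rewrite -scaleNr -[RHS]add0r -[X in X + _]cochain_of0 -cochain_ofDZ.
  by congr cochain_of; apply: funext => b; rewrite add0r scaleNr.
- move=> i j x y hx hy.
  rewrite (hoch_dE (brdeg _ _ _ _ hx hy)) (series_of_br _ _ _ _ hx hy).
  rewrite (sbrE (ddeg _ _ hx) hy) (sbrE hx (ddeg _ _ hy)).
  rewrite (series_of_d _ _ hx) (series_of_d _ _ hy).
  rewrite (lie_br_jacobi (@mu_deg k Q) (series_of_homog hx) (series_of_homog hy)) -cochain_ofDZ.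
  by rewrite mul1r [1 + i]addrC [1 + j]addrC.
- move=> i j l x y z hx hy hz.
  rewrite (sbrE hx (brdeg _ _ _ _ hy hz)) (sbrE (brdeg _ _ _ _ hx hy) hz).
  rewrite (sbrE hy (brdeg _ _ _ _ hx hz)) (series_of_br _ _ _ _ hy hz) (series_of_br _ _ _ _ hx hy).
  rewrite (series_of_br _ _ _ _ hx hz) -cochain_ofDZ.
  by rewrite (lie_br_jacobi (series_of_homog hx) (series_of_homog hy) (series_of_homog hz)).
Qed.
End DgLie.

(** * The L-infinity structure on the Bardzell complex *)

Section Linf.
Variables (k : fieldType) (Q : quiver).
Local Notation A := (rsz k Q).
Local Notation B := (basis Q).
Local Notation cochain := (cochain k Q).
Implicit Types (f g h : cochain) (p : qpath Q) (i j l : int).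

Lemma circ0l n m g : circ n m (0 : cochain) g = 0.
Proof.
apply: funext => p; rewrite /circ; case: ifP => // _; apply: big1 => i _.
by rewrite /ceval big1 ?scaler0 // => q _; rewrite scaler0.
Qed.

Lemma circ0r n m f : circ n m f (0 : cochain) = 0.
Proof.
apply: funext => p; rewrite /circ; case: ifP => // _; apply: big1 => i _.
by rewrite (ceval0 f (ltn_ord i)) ?scaler0 // ltnn eqxx.
Qed.

Lemma gbr0l n m g : gbr n m (0 : cochain) g = 0.
Proof. by rewrite /gbr circ0l circ0r scaler0 subr0. Qed.
Lemma gbr0r n m f : gbr n m f (0 : cochain) = 0.
Proof. by rewrite /gbr circ0l circ0r scaler0 subr0. Qed.

Lemma linf_phi0 n (xs : hseq k Q) : (1 < n)%N -> linf_phi n xs = 0.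
Proof. by move=> n1; rewrite linf_phiE // /hhom Hstar0 oppr0. Qed.

Lemma linf_l_ge3 n (xs : hseq k Q) : (2 < n)%N -> linf_l n xs = 0.
Proof.
case: n => [|[|n]] // n3.
rewrite -[RHS](Fstar_id (proj1 (@cdeg0 k Q 0))).
rewrite /linf_l /linf_l_of; congr Fstar.
rewrite /linf_v big_nat_cond big1 // => t; rewrite andbT => /andP[t1 t2].
apply: big1 => tau _; rewrite /sbr; case: (ltnP 1 t) => ht.
  by rewrite (linf_phi0 _ ht) gbr0l scaler0.
by rewrite [X in gbr _ _ _ X]linf_phi0 ?gbr0r ?scaler0 //; lia.
Qed.

(** With two arguments, the shuffle condition is empty and the condition on the
    first elements of the two blocks excludes the transposition. *)
Lemma shuffle_minus2 (tau : 'S_2) : shuffle_minus 1 tau = (tau == 1%g).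
Proof.
apply/andP/eqP => [[_ /forallP/(_ ord0)/forallP/(_ ord_max)/= h]|->].
  apply/permP => x; rewrite perm1; apply/val_inj.
  have := ltn_ord (tau ord0); have := ltn_ord (tau ord_max).
  have [-> | ->] : x = ord0 \/ x = ord_max; last 2 first.
  - by move: h => /=; lia.
  - by move: h => /=; lia.
  by case: x => -[|[|x]] hx //; [left|right]; apply/val_inj.
split.
  apply/forallP => x; apply/forallP => y; apply/implyP; rewrite !perm1.
  by case/andP.
apply/forallP => x; apply/forallP => y; apply/implyP; rewrite !perm1.
by case/andP => /eqP -> /eqP ->.
Qed.

Lemma linf_l2 i j f g : cdeg i f -> cdeg j g ->
  linf_l 2 [:: (i, f); (j, g)] = sbr i j f g.
Proof.
move=> hf hg.
rewrite /linf_l /linf_l_of /linf_v big_nat1 (big_pred1 (1%g : 'S_2)); last first.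
  by move=> tau; rewrite shuffle_minus2.
have -> : hperm (1%g : 'S_2) [:: (i, f); (j, g)] = [:: (i, f); (j, g)].
  by rewrite /hperm !enum_ordSl enum_ord0 /= !perm1.
have -> : chi (1%g : 'S_2) [:: (i, f); (j, g)] = 1.
  rewrite /chi odd_perm1 expr0 mul1r /epsilon big1 // => u _; rewrite big1 // => v.
  by rewrite !perm1 => /andP[uv vu]; move: uv vu; lia.
have -> : kappa 1 (1%g : 'S_2) [:: (i, f); (j, g)] = 1.
  rewrite /kappa; set X := degs _; by rewrite [X in sgn _ X](_ : _ = 0) //; lia.
rewrite mul1r scale1r /degs /= !big_seq1 !addrK !linf_phi1 /hnth /=.
case: (hf) (hg) => ef _ [eg _]; rewrite !Gstar_id //; apply: Fstar_id.
by rewrite sbrE //; apply: ebimod_cochain_of; apply: path_family_br; exact: series_of_path_family.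
Qed.

Lemma linf_l1E i f : cdeg i f -> linf_l 1 [:: (i, f)] = - bar_diff f.
Proof. by case=> hf _; rewrite -bdz_diff_bar. Qed.
End Linf.

Section Transfer.
Variables (k : fieldType) (V : lmodType k) (deg : int -> V -> Prop).
Variables (d d' : int -> V -> V) (br br' : int -> int -> V -> V -> V).
Hypothesis hd : forall i x, deg i x -> d i x = d' i x.
Hypothesis hbr : forall i j x y, deg i x -> deg j y -> br i j x y = br' i j x y.

Lemma is_dgLie_ext : is_dgLie (DglData deg d' br') -> is_dgLie (DglData deg d br).
Proof.
case=> /= h0 hlin ddeg dlin brdeg brl brr dd anti leib jac; split=> //=.
- by move=> i x hx; rewrite hd //; exact: ddeg.
- by move=> i c x y hx hy; rewrite !hd //; [exact: dlin|exact: hlin].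
- by move=> i j x y hx hy; rewrite hbr //; exact: brdeg.
- by move=> i j c x x' y hx hx' hy; rewrite !hbr //; [exact: brl|exact: hlin].
- by move=> i j c x y y' hx hy hy'; rewrite !hbr //; [exact: brr|exact: hlin].
- by move=> i x hx; rewrite !hd //; [exact: dd|exact: ddeg].
- by move=> i j x y hx hy; rewrite !hbr //; exact: anti.
- move=> i j x y hx hy; rewrite (hd hx) (hd hy) (hbr hx hy).
  rewrite (hbr (ddeg _ _ hx) hy) (hbr hx (ddeg _ _ hy)) hd; first exact: leib.
  exact: brdeg.
- move=> i j l x y z hx hy hz; rewrite (hbr hy hz) (hbr hx hy) (hbr hx hz).
  rewrite (hbr hx (brdeg _ _ _ _ hy hz)) (hbr (brdeg _ _ _ _ hx hy) hz).
  by rewrite (hbr hy (brdeg _ _ _ _ hx hz)); exact: jac.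
Qed.

Lemma MC_ext f : MC (DglData deg d br) f <-> MC (DglData deg d' br') f.
Proof.
have e (h : forall i, deg 1 (f i)) i :
  d 1 (f i) + 2%:R^-1 *: \sum_(j < i.+1) br 1 1 (f j) (f (i - j)%N)
  = d' 1 (f i) + 2%:R^-1 *: \sum_(j < i.+1) br' 1 1 (f j) (f (i - j)%N).
  by rewrite hd //; congr (_ + _ *: _); apply: eq_bigr => j _; rewrite hbr.
by split=> -[/= h0 h1 h2]; split=> //= i; move: (h2 i); rewrite e.
Qed.
End Transfer.

Section Main.
Variables (k : fieldType) (Q : quiver).
Local Notation A := (rsz k Q).
Local Notation cochain := (cochain k Q).
Implicit Types (f g h : cochain) (p : qpath Q).
Hypothesis two_neq0 : 2%:R != 0 :> k.

Lemma bdz_dgLie : is_dgLie (bdz_dgl k Q).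
Proof.
apply: is_dgLie_ext (hoch_dgLie Q two_neq0) => /=.
  by move=> i x; exact: linf_l1E.
by move=> i j x y; exact: linf_l2.
Qed.

Lemma MC_bdz_hoch (f : nat -> cochain) : MC (bdz_dgl k Q) f <-> MC (hoch_dgl k Q) f.
Proof.
apply: MC_ext.
  by move=> i x; exact: linf_l1E.
by move=> i j x y; exact: linf_l2.
Qed.

Lemma Gstar_quasi_iso :
  dgLie_quasi_iso (L := bdz_dgl k Q) (M := hoch_dgl k Q) (@Gstar k Q).
Proof.
have hG i f : cdeg i f -> Gstar f = f by case=> hf _; exact: Gstar_id.
have hB := bdz_dgLie; have hH := hoch_dgLie Q two_neq0.
have hd i f : cdeg i f -> linf_l 1 [:: (i, f)] = - bar_diff f by exact: linf_l1E.
split=> //.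
- split=> /=.
  + by move=> i x hx; rewrite (hG i).
  + by move=> i c x y hx hy; rewrite !(hG i) //; exact: cdeg_lin.
  + move=> i x hx; rewrite (hG _ _ (dgl_d_deg hB hx)) (hG _ _ hx).
    exact: hd.
  + move=> i j x y hx hy; rewrite (hG _ _ (dgl_br_deg hB hx hy)) (hG _ _ hx) (hG _ _ hy).
    exact: linf_l2.
- move=> i x [/= hx _] [y /= hy]; rewrite (hG i) // => ->.
  by exists y => //=; exact: esym (hd _ _ hy).
- move=> i z [/= hz dz]; exists z; first by split=> //=; exact: etrans (hd _ _ hz) dz.
  (* [G^*] being the identity, the representative is the cocycle itself. *)
  exists 0; first exact: cdeg0.
  by rewrite (hG i) // subrr /= bar_diff0 oppr0.
Qed.

Lemma Gstar_MC_bij :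
  set_bij (MC (bdz_dgl k Q)) (MC (hoch_dgl k Q)) (fun (f : nat -> cochain) i => Gstar (f i)).
Proof.
have hG (f : nat -> cochain) : (forall i, cdeg 1 (f i)) -> (fun i => Gstar (f i)) = f.
  by move=> h; apply: funext => i; apply: Gstar_id; case: (h i).
split.
- by move=> f /= hf; rewrite hG; [exact/MC_bdz_hoch|case: hf].
- by move=> f g /set_mem[_ hf _] /set_mem[_ hg _]; rewrite !hG.
- move=> f hf; exists f; first exact/MC_bdz_hoch.
  by rewrite hG //; case: hf.
Qed.
End Main.

(** * The Maurer-Cartan equation *)

Section MaurerCartan.
Variables (k : fieldType) (Q : quiver).
Local Notation A := (rsz k Q).
Local Notation cochain := (cochain k Q).
Implicit Types (f g h : cochain) (p : qpath Q).
Hypothesis two_neq0 : 2%:R != 0 :> k.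

Lemma evalG2E f (x y : A) : ebimod f -> evalG2 f x y = ceval 2 f (nth 0 [:: x; y]).
Proof.
move=> hf; rewrite /evalG2 bdz_hat_cmpG // bar_hat_tens // mul1r mulr1.
apply: eq_bigr => q _; congr (_ *: _); rewrite !ffunE !big_ord_recl !big_ord0 /=.
by rewrite !ffunE.
Qed.

Lemma circ22E f g p : ebimod f -> len p = 3 ->
  circ 2 2 f g p = evalG2 f (g (subp p 0 2)) (parr k p 2)
                   - evalG2 f (parr k p 0) (g (subp p 1 2)).
Proof.
move=> hf hp; rewrite !evalG2E // /circ hp eqxx !big_ord_recl big_ord0 /= addr0.
rewrite mul0n expr0 scale1r mul1n -signr_odd expr1 scaleN1r.
by congr (_ - _); apply: ceval_ext => -[|[|j]].
Qed.

(** The sum is symmetric under [j |-> i - j], and in degree [1] the bracket is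
    the symmetrization of [o]. *)
Lemma MC_circ (f : nat -> cochain) : f 0%N = 0 -> (forall i, cdeg 1 (f i)) ->
  MC (hoch_dgl k Q) f <-> forall i,
    - bar_diff (f i) + \sum_(1 <= j < i) circ 2 2 (f j) (f (i - j)%N) = 0.
Proof.
move=> f0 hf.
have E i : 2%:R^-1 *: \sum_(j < i.+1) sbr 1 1 (f j) (f (i - j)%N) =
    \sum_(1 <= j < i) circ 2 2 (f j) (f (i - j)%N).
  have s g h : sbr 1 1 g h = circ 2 2 g h + circ 2 2 h g.
    by rewrite /sbr [gbr _ _ _ _]/(circ 2 2 g h - (-1) *: circ 2 2 h g) scaleN1r opprK.
  under eq_bigr => j _ do rewrite s.
  rewrite big_split /= [X in _ + X](reindex_inj rev_ord_inj) /=.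
  rewrite [X in _ + X](_ : _ = \sum_(j < i.+1) circ 2 2 (f j) (f (i - j)%N)); last first.
    by apply: eq_bigr => j _; rewrite subSS subKn // -ltnS.
  rewrite -mulr2n -scaler_nat scalerA mulVf // scale1r.
  (* The terms with [j = 0] and [j = i] vanish since [f 0 = 0]. *)
  rewrite -(big_mkord xpredT (fun j => circ 2 2 (f j) (f (i - j)%N))).
  case: i => [|i]; first by rewrite big_nat1 f0 circ0l big_geq.
  by rewrite big_nat_recr //= subnn f0 circ0r addr0 big_nat_recl // f0 circ0l add0r big_add1.
split=> [[_ _ h] i|h]; first by rewrite -E; exact: h.
by split=> // i; have := h i; rewrite -E.
Qed.

(** The paths of length [3] are the index set of the explicit equations. *)
Lemma path3 p : len p = 3 -> exists (a1 a2 a3 : arrow Q)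
    (h12 : tgt a1 = src a2) (h23 : tgt a2 = src a3),
  [/\ subp p 0 2 = path2 h12, subp p 1 2 = path2 h23,
      parr k p 0 = arr k a1 & parr k p 2 = arr k a3].
Proof.
case: p => -[v [|a1 [|a2 [|a3 [|]]]]] // hc _; exists a1, a2, a3.
case/and4P: (hc) => /eqP e1 /eqP e2 /eqP e3 _.
by exists (esym e2), (esym e3); split=> //; apply: qpath_eq.
Qed.

Lemma path3_ex (a1 a2 a3 : arrow Q) (h12 : tgt a1 = src a2) (h23 : tgt a2 = src a3) :
  exists p, [/\ len p = 3, subp p 0 2 = path2 h12, subp p 1 2 = path2 h23,
      parr k p 0 = arr k a1 & parr k p 2 = arr k a3].
Proof.
have hc : chain (src a1) [:: a1; a2; a3] by rewrite /= h12 h23 !eqxx.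
exists (exist (fun p : vert Q * seq (arrow Q) => chain p.1 p.2) (src a1, [:: a1; a2; a3]) hc).
by split=> //; apply: qpath_eq.
Qed.

Lemma MC_bdz_equation (f : nat -> cochain) : f 0%N = 0 -> (forall i, cdeg 1 (f i)) ->
  MC (bdz_dgl k Q) f <->
  forall (i : nat) (a1 a2 a3 : arrow Q)
    (h12 : tgt a1 = src a2) (h23 : tgt a2 = src a3), (1 <= i)%N ->
    f i (path2 h12) * arr k a3 - arr k a1 * f i (path2 h23)
    + \sum_(1 <= j < i)
        (evalG2 (f j) (f (i - j)%N (path2 h12)) (arr k a3)
         - evalG2 (f j) (arr k a1) (f (i - j)%N (path2 h23))) = 0.
Proof.
move=> f0 hf; rewrite MC_bdz_hoch // MC_circ //.
have he i : ebimod (f i) by case: (hf i).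
have E i p : len p = 3 ->
  (- bar_diff (f i) + \sum_(1 <= j < i) circ 2 2 (f j) (f (i - j)%N)) p =
    f i (subp p 0 2) * parr k p 2 - parr k p 0 * f i (subp p 1 2)
    + \sum_(1 <= j < i)
        (evalG2 (f j) (f (i - j)%N (subp p 0 2)) (parr k p 2)
         - evalG2 (f j) (parr k p 0) (f (i - j)%N (subp p 1 2))).
  move=> hp; rewrite [LHS]/(- bar_diff (f i) p + (\sum_(1 <= j < i) _) p).
  rewrite fct_sumE; congr (_ + _); last by apply: eq_bigr => j _; exact: circ22E.
  rewrite bar_diff_rsz_delta // /rsz_delta hp /= -signr_odd scale1r -signr_odd expr1 scaleN1r.
  by rewrite opprD opprK addrC.
have Z i p : len p != 3 ->
  (- bar_diff (f i) + \sum_(1 <= j < i) circ 2 2 (f j) (f (i - j)%N)) p = 0.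
  move=> hp; rewrite [LHS]/(- bar_diff (f i) p + (\sum_(1 <= j < i) _) p).
  rewrite fct_sumE big1 => [|j _]; last by rewrite /circ eqSS (negbTE hp).
  suff -> : bar_diff (f i) p = 0 by rewrite oppr0; exact: addr0.
  rewrite bar_diff_rsz_delta // /rsz_delta.
  case e: (len p) hp => [|n] hp; first by rewrite scaler0.
  have hn : n%:Z != 1 + 1 by move: hp; lia.
  rewrite !(hf i).2 ?len_subp ?e; [|by move: hn; lia..].
  by rewrite mulr0 mul0r scaler0 (addr0 (0 : A)) scaler0.
split=> [h i a1 a2 a3 h12 h23 _|h i].
  have [p [hp <- <- <- <-]] := path3_ex h12 h23.
  by rewrite -E // h.
apply: funext => p; have [hp|hp] := eqVneq (len p) 3; last by rewrite Z.
rewrite E //; have [a1 [a2 [a3 [h12 [h23 [-> -> -> ->]]]]]] := path3 hp.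
case: i => [|i]; last exact: h.
by rewrite big_geq // f0 mul0r mulr0 subr0 addr0.
Qed.
End MaurerCartan.

Theorem theorem4p7 (k : fieldType) (hk : [pchar k] =i pred0) (Q : quiver) :
  [/\ (forall (n : nat) (xs : n.-tuple (int * cochain k Q)),
         (3 <= n)%N -> homogeneous xs -> linf_l n xs = 0),
      is_dgLie (bdz_dgl k Q),
      dgLie_quasi_iso (L := bdz_dgl k Q) (M := hoch_dgl k Q) (@Gstar k Q),
      set_bij (MC (bdz_dgl k Q)) (MC (hoch_dgl k Q)) (fun f i => Gstar (f i)) &
      forall f : nat -> cochain k Q, f 0%N = 0 -> (forall i, cdeg 1 (f i)) ->
        MC (bdz_dgl k Q) f <->
        forall (i : nat) (a1 a2 a3 : arrow Q)
          (h12 : tgt a1 = src a2) (h23 : tgt a2 = src a3), (1 <= i)%N ->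
          f i (path2 h12) * arr k a3 - arr k a1 * f i (path2 h23)
          + \sum_(1 <= j < i)
              (evalG2 (f j) (f (i - j)%N (path2 h12)) (arr k a3)
               - evalG2 (f j) (arr k a1) (f (i - j)%N (path2 h23))) = 0].
Proof.
have two_neq0 : 2%:R != 0 :> k by have/pcharf0P -> := hk.
split.
- by move=> n xs n3 _; exact: linf_l_ge3.
- exact: bdz_dgLie.
- exact: Gstar_quasi_iso.
- exact: Gstar_MC_bij.
- exact: MC_bdz_equation.
Qed.
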